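(* For every integer $n \ge 2$, if $\beta\in[0,1]$ is sufficiently close to $1$ (how close depending on $n$), then $r_n(\beta) \le 1-\frac{3}{10}\beta(1-\beta)$. That is, for every integer $n\ge 2$ there exists $\varepsilon>0$ such that for all $\beta\in[0,1]$ with $1-\beta<\varepsilon$ one has $r_n(\beta) \le 1-\frac{3}{10}\beta(1-\beta)$.
   Context: For a complex number $\beta$ with $|\beta|\le 1$, $S(\beta)$ denotes the set of polynomials of degree at least $2$ with complex coefficients, having all their roots in the closed unit disk $\{z\in\mathbb{C}: |z|\le 1\}$ and at least one root at $\beta$. For a polynomial $P$ (of degree at least $2$), $d(P,\beta)$ denotes the distance between $\beta$ and the closest root of the derivative $P'$, i.e. $d(P,\beta)=\min\{|\beta-\zeta| : P'(\zeta)=0\}$. For an integer $n\ge 2$, $r_n(\beta)=\sup\{d(P,\beta) : P\in S(\beta),\ \deg P=n\}$. *)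

(* Defs.v *)
From mathcomp Require Import all_boot all_order all_algebra.
From mathcomp Require Import all_classical all_reals all_analysis.
From mathcomp Require Import complex.

Set Implicit Arguments.
Unset Strict Implicit.
Unset Printing Implicit Defensive.

Import Order.TTheory GRing.Theory Num.Theory.
Import ComplexField.Normc.

Local Open Scope classical_set_scope.
Local Open Scope ring_scope.
Local Open Scope complex_scope.

(* [size P] is [deg P + 1], so [2 < size P] means [deg P >= 2]. The norm [`|z|]
   of [R[i]] takes values in [R[i]]; [`|z| <= 1] there is [normc z <= 1] in [R].
*)
Definition disk_polys (R : realType) (beta : R[i]) : set {poly R[i]} :=
  [set P : {poly R[i]} |
    [/\ (2 < size P)%N, forall z : R[i], root P z -> `|z| <= 1 & root P beta]].

(* The infimum is a minimum when [deg P >= 2], see [crit_dist_min]. *)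
Definition crit_dist (R : realType) (P : {poly R[i]}) (beta : R[i]) : R :=
  inf [set normc (beta - zeta) | zeta in [set zeta | root P^`() zeta]].

(* The supremum is taken in the extended reals, so that it has its usual meaning
   without a side condition of boundedness. *)
Definition max_crit_dist (R : realType) (n : nat) (beta : R[i]) : \bar R :=
  ereal_sup [set (crit_dist P beta)%:E | P in
              [set P | disk_polys beta P /\ size P = n.+1]].

Lemma size_deriv_complex (R : realType) (P : {poly R[i]}) :
  size P^`() = (size P).-1.
Proof.
have [lt1P | le_P1] := ltnP 1 (size P); last first.
  by rewrite (size1_polyC le_P1) derivC size_poly0 size_polyC; case: (_ != _).
rewrite size_poly_eq // mulrn_eq0 negb_or.
have -> : (size P).-2.+1 = (size P).-1 by case: (size P) lt1P => [|[]].
rewrite lead_coef_eq0 -size_poly_gt0 (ltnW lt1P) andbT.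
by case: (size P) lt1P => [|[]].
Qed.

Lemma crit_dist_min (R : realType) (P : {poly R[i]}) (beta : R[i]) :
  (2 < size P)%N ->
  exists2 zeta, root P^`() zeta &
    crit_dist P beta = normc (beta - zeta) /\
    forall xi, root P^`() xi -> normc (beta - zeta) <= normc (beta - xi).
Proof.
move=> sP; set Q := P^`().
have sQ : (1 < size Q)%N by rewrite size_deriv_complex; case: (size P) sP.
have Q0 : Q != 0 by rewrite -size_poly_gt0 ltnW.
have [rs Qrs] := closed_field_poly_normal Q.
have rootQ z : root Q z = (z \in rs).
  by rewrite Qrs rootZ ?lead_coef_eq0 // root_prod_XsubC.
have [z0 z0rs] : exists z, z \in rs.
  case: rs Qrs {rootQ} => [Qrs|z rs _]; last by exists z; rewrite mem_head.
  by move: sQ; rewrite Qrs big_nil size_scale ?lead_coef_eq0 // size_poly1.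
have [zeta zrs zmin] : exists2 zeta, zeta \in rs &
    forall xi, xi \in rs -> normc (beta - zeta) <= normc (beta - xi).
  elim: rs z0 z0rs {Qrs rootQ} => // a [|b rs] IH z0 _.
    by exists a; rewrite ?mem_head // => xi; rewrite inE => /eqP->.
  have [z zrs zmin] := IH b (mem_head _ _).
  have [le|lt] := leP (normc (beta - a)) (normc (beta - z)).
    exists a; first exact: mem_head.
    by move=> xi; rewrite inE => /predU1P[->//|/zmin]; apply: le_trans.
  exists z; first by rewrite inE zrs orbT.
  by move=> xi; rewrite inE => /predU1P[->|/zmin//]; apply: ltW.
exists zeta; first by rewrite rootQ.
split; last by move=> xi; rewrite rootQ; exact: zmin.
apply/eqP; rewrite eq_le; apply/andP; split.
  apply: ge_inf; last by exists zeta => //=; rewrite rootQ.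
  by exists (normc (beta - zeta)) => _ [xi /= + <-]; rewrite rootQ; exact: zmin.
apply: lb_le_inf; first by exists (normc (beta - zeta)), zeta => //=; rewrite rootQ.
by move=> _ [xi /= + <-]; rewrite rootQ; exact: zmin.
Qed.

(* Main.v *)
Require Import Defs.
From mathcomp Require Import all_boot all_order all_algebra.
From mathcomp Require Import all_classical all_reals all_analysis.
From mathcomp Require Import complex.
From mathcomp Require Import cyclic separable cyclotomic ring lra zify.

(** Write [n] for the degree, [d = 1 - beta = s^2], and suppose that every
   critical point [zeta] of [P] satisfies [|beta - zeta| > 1 - 3/10 beta d]. The
   identity [sum 1/(beta - zeta) = 2 sum 1/(beta - u)], where [u] runs over the
   other roots of [P], forces [zeta = O(s^2) + i O(s)]. For a root of unity
   [w^n = 1], all roots being in the unit disk gives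
   [Re (w P'(w) / P(w)) >= n / 2], where [P(w)] is small and [w P'(w) / n] is
   close to [1]; expanding in the elementary symmetric functions of the [zeta]
   yields, with [c = Re w] and [Y = sum (Im zeta)^2],
   [(3 + 7 c)/10 s^2 + Y ((1 - c)/(2 (n-1)) - (1 - c^2)/(n-2)) >= - O(s^3)].
   If [n >= 3] and [n <> 5], some nonnegative combination of these inequalities
   over the [n]-th roots of unity has a negative coefficient at [s^2] and a
   nonpositive one at [Y], so [s] is bounded below. For [n = 5] the best
   combination is exactly [0 >= - O(s^3)]. All the constraints are then tight at
   first order, and the expansion is pushed to order [s^4], where it reads
   [- 59/20 s^4 - 5 b1 b2 b3 b4 >= - O(s^5)] with [bj = Im zeta_j] and
   [|b1 b2 b3 b4| <= (Y/4)^2 = 9/25 s^4 + O(s^5)]. *)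

Set Implicit Arguments.
Unset Strict Implicit.
Unset Printing Implicit Defensive.

Import Order.TTheory GRing.Theory Num.Theory.
Import ComplexField.Normc.

Local Open Scope ring_scope.
Local Open Scope complex_scope.
Local Notation Re := complex.Re.
Local Notation Im := complex.Im.
Local Notation sqn x := (Re x ^+ 2 + Im x ^+ 2).

(** * Orders of magnitude *)

(* The members [i : I] of the family are the hypothetical counterexamples: a
   bound with a constant uniform in [i] replaces a limit [s -> 0]. *)
Definition isO (R : realFieldType) (I : Type) (s : I -> R) (k : nat)
    (f : I -> R) : Prop :=
  exists K, forall i, `|f i| <= K * s i ^+ k.

Section Orders.
Variables (R : realFieldType) (I : Type) (s : I -> R).
Hypothesis s01 : forall i, 0 <= s i <= 1.
Notation O := (isO s).

Let sX_ge0 i k : 0 <= s i ^+ k.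
Proof. by rewrite exprn_ge0 //; case/andP: (s01 i). Qed.

Lemma isOP k f :
  O k f -> exists2 K, 0 <= K & forall i, `|f i| <= K * s i ^+ k.
Proof.
case=> K HK; exists `|K|; rewrite ?normr_ge0 // => i.
by apply: le_trans (HK i) _; rewrite ler_wpM2r // ler_norm.
Qed.

Lemma isO_ext (k : nat) f g : f =1 g -> O k f -> O k g.
Proof. by move=> fg [K HK]; exists K => i; rewrite -fg. Qed.

Lemma isO_weak (k l : nat) f : (l <= k)%N -> O k f -> O l f.
Proof.
move=> lk /isOP[K K0 HK]; exists K => i; apply: le_trans (HK i) _.
by rewrite ler_wpM2l // ler_wiXn2l //; case/andP: (s01 i).
Qed.

Lemma isO_cst c : O 0 (fun=> c).
Proof. by exists `|c| => i; rewrite expr0 mulr1. Qed.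

Lemma isO0 k : O k (fun=> 0).
Proof. by exists 0 => i; rewrite normr0 mul0r. Qed.

Lemma isO_s : O 1 s.
Proof.
by exists 1 => i; rewrite mul1r expr1 ger0_norm //; case/andP: (s01 i).
Qed.

Lemma isO_add k f g : O k f -> O k g -> O k (fun i => f i + g i).
Proof.
move=> [K HK] [L HL]; exists (K + L) => i.
by rewrite (le_trans (ler_normD _ _)) // mulrDl lerD.
Qed.

Lemma isO_opp k f : O k f -> O k (fun i => - f i).
Proof. by move=> [K HK]; exists K => i; rewrite normrN. Qed.

Lemma isO_sub k f g : O k f -> O k g -> O k (fun i => f i - g i).
Proof. by move=> Of Og; apply: isO_add => //; apply: isO_opp. Qed.

Lemma isO_mul k l f g : O k f -> O l g -> O (k + l) (fun i => f i * g i).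
Proof.
move=> [K HK] [L HL]; exists (K * L) => i.
by rewrite normrM exprD mulrACA ler_pM.
Qed.

Lemma isO_mulw m k l f g :
  (m <= k + l)%N -> O k f -> O l g -> O m (fun i => f i * g i).
Proof. by move=> mkl Of Og; apply: isO_weak mkl _; apply: isO_mul. Qed.

Lemma isO_mull k f g : O 0 f -> O k g -> O k (fun i => f i * g i).
Proof. exact: isO_mulw. Qed.

Lemma isO_exp k f m : O k f -> O (k * m) (fun i => f i ^+ m).
Proof.
move=> Of; elim: m => [|m IH].
  by rewrite muln0; apply: isO_ext (isO_cst 1) => i; rewrite expr0.
by rewrite mulnS; apply: isO_ext (isO_mul Of IH) => i; rewrite exprS.
Qed.

Lemma isO_sum (J : eqType) (r : seq J) k (f : J -> I -> R) :
  (forall j, j \in r -> O k (f j)) -> O k (fun i => \sum_(j <- r) f j i).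
Proof.
elim: r => [|j r IH] Of.
  by apply: isO_ext (isO0 k) => i; rewrite big_nil.
apply: isO_ext (isO_add (Of j (mem_head _ _)) (IH _)) => [i|l lr].
  by rewrite big_cons.
by apply: Of; rewrite inE lr orbT.
Qed.

Lemma isO_sandwich k f g h :
  O k g -> O k h -> (forall i, g i <= f i <= h i) -> O k f.
Proof.
move=> [K HK] [L HL] gfh; exists (K + L) => i; rewrite mulrDl ler_norml.
have := HK i; have := HL i; case/andP: (gfh i); rewrite !ler_norml.
by move=> gf fh /andP[? ?] /andP[? ?]; apply/andP; split; lra.
Qed.

(** Cancelling [s^k] in [a s^k <= K s^(k+1)] leaves [a <= K s]. A contradictory expansion thus
    becomes a lower bound for [s], uniform over the family. *)
Lemma isO_away (a : R) k f :
  (forall i, 0 < s i) -> 0 < a -> O k.+1 f -> (forall i, a * s i ^+ k <= f i) ->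
  exists2 eps, 0 < eps & forall i, eps <= s i.
Proof.
move=> s0 a0 [K HK] af; exists (a / (`|K| + 1)) => [|i].
  by rewrite divr_gt0 // ltr_wpDl.
rewrite ler_pdivrMr ?ltr_wpDl //.
have sk : 0 < s i ^+ k by rewrite exprn_gt0.
have : a * s i ^+ k <= K * s i * s i ^+ k.
  by rewrite -mulrA -exprS (le_trans (af i)) // (le_trans (ler_norm _)).
rewrite ler_pM2r // => aK; apply: le_trans aK _; rewrite mulrC.
by rewrite ler_wpM2l ?(ltW (s0 i)) // (le_trans (ler_norm K)) // lerDl.
Qed.

Lemma isO_min k l f g :
  O k f -> O l g -> O (minn k l) (fun i => f i + g i).
Proof.
by move=> Of Og; apply: isO_add; [apply: isO_weak Of | apply: isO_weak Og];
   rewrite // ?geq_minl ?geq_minr.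
Qed.

(* [geO k f] means [f >= - O(s^k)]. *)
Definition geO k (f : I -> R) : Prop := exists2 g, O k g & forall i, g i <= f i.

Lemma geO_le k f g : geO k f -> (forall i, f i <= g i) -> geO k g.
Proof. by case=> h Oh hf fg; exists h => // i; apply: le_trans (fg i). Qed.

Lemma isO_geO k f : O k f -> geO k f.
Proof. by move=> Of; exists f. Qed.

Lemma geO_weak k l f : (l <= k)%N -> geO k f -> geO l f.
Proof. by move=> lk [g Og gf]; exists g => //; apply: isO_weak Og. Qed.

Lemma geO_add k f g : geO k f -> geO k g -> geO k (fun i => f i + g i).
Proof.
move=> [f' Of ff] [g' Og gg]; exists (fun i => f' i + g' i).
  exact: isO_add.
by move=> i; apply: lerD.
Qed.

Lemma geO_scale k c f : 0 <= c -> geO k f -> geO k (fun i => c * f i).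
Proof.
move=> c0 [g Og gf]; exists (fun i => c * g i) => [|i].
  exact: isO_mull (isO_cst c) Og.
by rewrite ler_wpM2l.
Qed.

Lemma geO_sum (J : eqType) (r : seq J) k (f : J -> I -> R) :
  (forall j, j \in r -> geO k (f j)) -> geO k (fun i => \sum_(j <- r) f j i).
Proof.
elim: r => [|j r IH] Of.
  by apply: geO_le (isO_geO (isO0 k)) _ => i; rewrite big_nil.
have Or l : l \in r -> geO k (f l) by move=> lr; apply: Of; rewrite inE lr orbT.
apply: geO_le (geO_add (Of j (mem_head _ _)) (IH Or)) _ => i.
by rewrite big_cons.
Qed.

Lemma geO_isO k f : geO k f -> geO k (fun i => - f i) -> O k f.
Proof.
move=> [g Og gf] [h Oh hf]; apply: isO_sandwich Og (isO_opp Oh) _ => i.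
by rewrite gf lerNr hf.
Qed.

Lemma geO_eqmod k f g : O k (fun i => f i - g i) -> geO k f -> geO k g.
Proof.
move=> Ofg Lf; apply: geO_le (geO_add Lf (isO_geO (isO_opp Ofg))) _ => i.
by rewrite opprB addrC subrK.
Qed.

Lemma isO_eqmod k f g : O k (fun i => f i - g i) -> O k g -> O k f.
Proof.
by move=> Ofg Og; apply: isO_ext (isO_add Ofg Og) => i; rewrite subrK.
Qed.

End Orders.

(* Infers an order for an expression built from [+], [-], [*], [^+] and
   hypotheses [isO s k x], then compares it with the order in the goal. When two
   orders of the same [x] are in the context, the weaker one must be cleared. *)
Ltac isO_infer s01 :=
  lazymatch goal with
  | H : isO _ _ ?f |- isO _ _ ?f => eapply H
  | |- isO _ _ (fun _ => ?c) => eapply isO_cst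
  | |- isO _ _ (fun i => @GRing.add _ (@?f i) (@?g i)) =>
      eapply (@isO_min _ _ _ s01 _ _ f g); isO_infer s01
  | |- isO _ _ (fun i => @GRing.mul _ (@?f i) (@?g i)) =>
      eapply (@isO_mul _ _ _ _ _ f g); isO_infer s01
  | |- isO _ _ (fun i => @GRing.opp _ (@?f i)) =>
      eapply (@isO_opp _ _ _ _ f); isO_infer s01
  | |- isO _ _ (fun i => @GRing.exp _ (@?f i) ?m) =>
      eapply (@isO_exp _ _ _ _ f m); isO_infer s01
  | _ => first [ eassumption | eapply (isO_s s01) ]
  end.
Ltac isO_tac s01 := eapply (isO_weak s01); [ | isO_infer s01 ]; by [].

(* With [A = P(w)/n] and [B = w P'(w)/n] close to [1], [Re (A conj B) >= m |A|^2]
   is, up to second-order terms, [Re A >= 0]. *)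
Lemma geO_key (R : realFieldType) (I : Type) (s : I -> R) (k : nat) (m : R)
    (A1 A2 B1 B2 : I -> R) : (forall i, 0 <= s i <= 1) ->
  isO s k A1 -> isO s k A2 -> isO s k (fun i => B1 i - 1) -> isO s k B2 ->
  (forall i, m * (A1 i ^+ 2 + A2 i ^+ 2) <= A1 i * B1 i + A2 i * B2 i) ->
  geO s (k + k) A1.
Proof.
move=> s01 OA1 OA2 OB1 OB2 crit_key.
exists (fun i => m * (A1 i * A1 i + A2 i * A2 i) - A1 i * (B1 i - 1)
                 - A2 i * B2 i) => [|i]; last by have := crit_key i; lra.
have OO f g := @isO_mul _ _ s k k f g.
by apply: isO_sub; [apply: isO_sub; [apply: (isO_mull s01 (isO_cst s m));
   apply: isO_add|]|]; apply: OO.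
Qed.

(** * The distance constraint on one critical point *)

Section Away.
Variables (R : realFieldType) (I : Type) (s : I -> R).
Hypothesis s01 : forall i, 0 <= s i <= 1.
Implicit Types a b : I -> R.

(* [|beta - (a + i b)| >= 1 - 3/10 beta (1 - beta)] with [beta = 1 - s^2]. *)
Definition away a b := forall i,
  (1 - 3 / 10 * (1 - s i ^+ 2) * s i ^+ 2) ^+ 2 <=
  (1 - s i ^+ 2 - a i) ^+ 2 + b i ^+ 2.

(** Half the difference between the two sides of [away], cut to its terms of order [s^2] when
    [a = O(s^2)] and [b = O(s)]. *)
Definition away_slack a b i := - (7 / 10) * s i ^+ 2 + b i ^+ 2 / 2 - a i.

Lemma away_slack_ge a b : away a b -> forall i,
  - ((s i ^+ 2 + a i) ^+ 2) / 2 + 69 / 200 * s i ^+ 4 - 9 / 100 * s i ^+ 6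
  + 9 / 200 * s i ^+ 8 <= away_slack a b i.
Proof. by move=> D i; have := D i; rewrite /away_slack; lra. Qed.

Lemma geO_away_slack a b : isO s 2 a -> away a b -> geO s 4 (away_slack a b).
Proof.
move=> Oa /away_slack_ge D; eexists; last exact: D.
isO_tac s01.
Qed.

End Away.

(** * Degree five *)

(* [Ek + i Hk] is the [k]-th elementary symmetric function of the four critical
   points. For [w = c + i S] with [w^5 = 1 <> w], the real part of [P(w)/5] is the
   sum of [symA5], even in [S], and [asymA5], odd in [S]; its imaginary part is
   [imA5], and [w P'(w)/5] is [reB5 + i imB5]. We use [Re w^2 = - 1/2 - c]. *)
Section DegreeFive.
Variables (R : realFieldType) (I : Type) (s : I -> R).
Hypothesis s01 : forall i, 0 <= s i <= 1.
Variables (E1 E2 E3 E4 H1 H2 H3 H4 : I -> R).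
Hypotheses (OE1 : isO s 2 E1) (OE2 : isO s 2 E2) (OE3 : isO s 4 E3)
  (OE4 : isO s 4 E4) (OH1 : isO s 1 H1) (OH2 : isO s 3 H2)
  (OH3 : isO s 3 H3) (OH4 : isO s 4 H4).
Notation b i := (1 - s i ^+ 2).

Definition symA5 (c : R) i :=
  (1 - b i ^+ 5) / 5 + E1 i * (b i ^+ 4 - c) / 4
  - E2 i * (b i ^+ 3 - (- (1 / 2) - c)) / 3
  + E3 i * (b i ^+ 2 - (- (1 / 2) - c)) / 2 - E4 i * (b i - c).
Definition asymA5 (c S : R) i :=
  S * (- (H1 i / 4) + 2 * c * H2 i / 3 + c * H3 i - H4 i).
Definition imA5 (c S : R) i :=
  (E1 i * S + H1 i * (b i ^+ 4 - c)) / 4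
  - (E2 i * (2 * c * S) + H2 i * (b i ^+ 3 - (- (1 / 2) - c))) / 3
  + (- (E3 i * (2 * c * S)) + H3 i * (b i ^+ 2 - (- (1 / 2) - c))) / 2
  - (- (E4 i * S) + H4 i * (b i - c)).
Definition reB5 (c S : R) i :=
  1 - (E1 i * c + H1 i * S) + (E2 i * (- (1 / 2) - c) + H2 i * (2 * c * S))
  - (E3 i * (- (1 / 2) - c) - H3 i * (2 * c * S)) + (E4 i * c - H4 i * S).
Definition imB5 (c S : R) i :=
  - (H1 i * c - E1 i * S) + (H2 i * (- (1 / 2) - c) - E2 i * (2 * c * S))
  - (E3 i * (2 * c * S) + H3 i * (- (1 / 2) - c)) + (E4 i * S + H4 i * c).

(** The inequality [Re (w P'(w) / P(w)) >= 5/2] multiplied by [|P(w)/5|^2], so that it keeps a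
    meaning when [P(w) = 0]. *)
Definition key5 (c S : R) := forall i,
  5 / 2 * ((symA5 c i + asymA5 c S i) ^+ 2 + imA5 c S i ^+ 2) <=
  (symA5 c i + asymA5 c S i) * reB5 c S i + imA5 c S i * imB5 c S i.

Lemma symA5_lin c : isO s 4
  (fun i => symA5 c i - (s i ^+ 2 + E1 i * (1 - c) / 4 - E2 i * (3 / 2 + c) / 3)).
Proof.
(* [isO_tac] reads orders off the syntax, so the powers of [1 - s^2] are first expanded and the
   leading terms cancelled by hand. The explicit witnesses given to [isO_ext] below serve the same
   purpose. *)
apply: (@isO_ext _ _ _ _ (fun i =>
  s i ^+ 4 * (- 2 + 2 * s i ^+ 2 - s i ^+ 4 + s i ^+ 6 / 5)
  + E1 i * (s i ^+ 2 * (- 4 + 6 * s i ^+ 2 - 4 * s i ^+ 4 + s i ^+ 6)) / 4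
  - E2 i * (s i ^+ 2 * (- 3 + 3 * s i ^+ 2 - s i ^+ 4)) / 3
  + E3 i * (b i ^+ 2 - (- (1 / 2) - c)) / 2 - E4 i * (b i - c))).
  by move=> i; rewrite /symA5; field.
isO_tac s01.
Qed.

(** Modulo [O(s^2)], only [- S H1 / 4] is left of [Re A >= 0]. It changes sign with [S], so [w] and
    its conjugate bound [H1] on both sides. *)
Lemma isO2_H1 (c S : R) : 0 < S -> key5 c S -> key5 c (- S) -> isO s 2 H1.
Proof.
move=> S0 kp km.
have Osym : isO s 2 (symA5 c).
  have h : isO s 2
    (fun i => s i ^+ 2 + E1 i * (1 - c) / 4 - E2 i * (3 / 2 + c) / 3).
    isO_tac s01.
  by apply: isO_eqmod h; apply: (isO_weak s01 _ (symA5_lin c)).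
have main T : key5 c T -> geO s 2 (fun i => - (T / 4 * H1 i)).
  move=> kT.
  apply: (@geO_eqmod _ _ _ _ (fun i => symA5 c i + asymA5 c T i)).
    apply: (@isO_ext _ _ _ _ (fun i =>
      symA5 c i + T * (2 * c * H2 i / 3 + c * H3 i - H4 i))).
      by move=> i; rewrite /asymA5; field.
    isO_tac s01.
  apply: (@geO_key _ _ _ 1 (5 / 2) _ (imA5 c T) (reB5 c T) (imB5 c T) s01 _ _ _ _ kT).
  - rewrite /asymA5; isO_tac s01.
  - rewrite /imA5; isO_tac s01.
  - apply: (@isO_ext _ _ _ _ (fun i => - (E1 i * c + H1 i * T)
  + (E2 i * (- (1 / 2) - c) + H2 i * (2 * c * T))
  - (E3 i * (- (1 / 2) - c) - H3 i * (2 * c * T)) + (E4 i * c - H4 i * T))).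
      by move=> i; rewrite /reB5; ring.
    isO_tac s01.
  - rewrite /imB5; isO_tac s01.
have L1 := main _ kp; have L2 := main _ km.
have O1 : isO s 2 (fun i => S / 4 * H1 i).
  apply: geO_isO L1; apply: geO_le L2 _ => i.
  by rewrite !mulNr opprK.
apply: (@isO_ext _ _ _ _ (fun i => (4 / S) * (S / 4 * H1 i))).
  by move=> i; field; lra.
isO_tac s01.
Qed.

Hypothesis OH1' : isO s 2 H1.

Lemma isO_symA5 c : isO s 2 (symA5 c).
Proof.
apply: isO_eqmod (isO_weak s01 _ (symA5_lin c)) _ => //; isO_tac s01.
Qed.

Lemma isO_imA5 c S : isO s 2 (imA5 c S).
Proof. clear OH1; rewrite /imA5; isO_tac s01. Qed.

Lemma isO_imB5 c S : isO s 2 (imB5 c S).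
Proof. clear OH1; rewrite /imB5; isO_tac s01. Qed.

Lemma isO_reB5 c S : isO s 2 (fun i => reB5 c S i - 1).
Proof.
clear OH1; apply: (@isO_ext _ _ _ _ (fun i =>
  - (E1 i * c + H1 i * S) + (E2 i * (- (1 / 2) - c) + H2 i * (2 * c * S))
  - (E3 i * (- (1 / 2) - c) - H3 i * (2 * c * S)) + (E4 i * c - H4 i * S))).
  by move=> i; rewrite /reB5; ring.
isO_tac s01.
Qed.

(** Now that [H1 = O(s^2)], both [A] and [B - 1] have order [s^2], and the error in [geO_key]
    improves from [s^2] to [s^4]. *)
Lemma geO_reA5 c S : key5 c S -> geO s 4 (fun i => symA5 c i + asymA5 c S i).
Proof.
move=> k5; apply: (geO_key s01 _ (isO_imA5 c S) (isO_reB5 c S) (isO_imB5 c S) k5).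
have := isO_symA5 c => ?; clear OH1; rewrite /asymA5; isO_tac s01.
Qed.

Lemma geO_symA5 c S : key5 c S -> key5 c (- S) -> geO s 4 (symA5 c).
Proof.
move=> kp km; have s12 : 0 <= 1 / 2 :> R by lra.
apply: geO_le (geO_scale s01 s12 (geO_add (geO_reA5 kp) (geO_reA5 km))) _ => i.
by rewrite /asymA5; lra.
Qed.

(** * Degree five: expansion to order [s^4] at the two pairs of primitive fifth roots of unity *)

Variables (c c' S S' : R).
Hypotheses (hc : 4 * c ^+ 2 + 2 * c = 1) (cc' : c' = - (1 / 2) - c)
  (c0 : 0 < c) (c1 : c < 1) (S0 : 0 < S) (cS : c ^+ 2 + S ^+ 2 = 1)
  (cS' : c' ^+ 2 + S' ^+ 2 = 1).
Hypotheses (kp : key5 c S) (km : key5 c (- S)).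
Hypotheses (kp' : key5 c' S') (km' : key5 c' (- S')).

(* With the weights [3 - 2 c] at the primitive fifth roots of unity, the terms of
   order [s^2] cancel up to the total slack of the four constraints on the
   critical points. *)
Definition slack5 i := E2 i - E1 i - 14 / 5 * s i ^+ 2.

Lemma sum_symA5 : isO s 4 (fun i =>
  (3 - 2 * c) * symA5 c i + (3 - 2 * c') * symA5 c' i + 5 / 2 * slack5 i).
Proof.
apply: (@isO_ext _ _ _ _ (fun i =>
  (3 - 2 * c) * (symA5 c i
    - (s i ^+ 2 + E1 i * (1 - c) / 4 - E2 i * (3 / 2 + c) / 3))
  + (3 - 2 * c') * (symA5 c' i
    - (s i ^+ 2 + E1 i * (1 - c') / 4 - E2 i * (3 / 2 + c') / 3)))).
  move=> i; rewrite /slack5.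
  have h1 := congr1 (fun x => E1 i * x) hc.
  have h2 := congr1 (fun x => E2 i * x) hc.
  by rewrite cc' /= in h1 h2 *; lra.
have := symA5_lin c => ?; have := symA5_lin c' => ?; isO_tac s01.
Qed.

Hypothesis Lslack : geO s 4 slack5.

(** The weights [3 - 2 c] are nonnegative and each [symA5] is [>= - O(s^4)]; by [sum_symA5] this
    bounds [slack5] above, while [Lslack] bounds it below. *)
Lemma isO_slack5 : isO s 4 slack5.
Proof.
apply: (geO_isO Lslack).
have c30 : 0 <= 3 - 2 * c by have := c1 => ?; lra.
have c30' : 0 <= 3 - 2 * c' by have := c0 => ?; rewrite cc'; lra.
have h : 0 <= 2 / 5 :> R by lra.
have L := geO_add (geO_scale s01 c30 (geO_symA5 kp km))
  (geO_scale s01 c30' (geO_symA5 kp' km')).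
apply: geO_le (geO_scale s01 h (geO_add L (isO_geO (isO_opp sum_symA5)))) _.
by move=> i /=; lra.
Qed.

(** Eliminating [E1] through [slack5] turns [symA5 x] into [- (1/4 + 7/12 x) (E2 - 6/5 s^2)] up to
    [O(s^4)]. The factor [1/4 + 7/12 x] is positive at [c] and negative at [c'], which pins [E2]
    from both sides. *)
Lemma isO_E2 : isO s 4 (fun i => E2 i - 6 / 5 * s i ^+ 2).
Proof.
have aux x : isO s 4 (fun i => symA5 x i
    - - (1 / 4 + 7 / 12 * x) * (E2 i - 6 / 5 * s i ^+ 2)).
  apply: (@isO_ext _ _ _ _ (fun i => (symA5 x i
    - (s i ^+ 2 + E1 i * (1 - x) / 4 - E2 i * (3 / 2 + x) / 3)) - slack5 i * ((1 - x) / 4))).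
    by move=> i; rewrite /slack5; field.
  by have := symA5_lin x => ?; have := isO_slack5 => ?; isO_tac s01.
have L := geO_eqmod (aux c) (geO_symA5 kp km).
have L' := geO_eqmod (aux c') (geO_symA5 kp' km').
apply: geO_isO.
  have p0 : 0 <= - (1 / (1 / 4 + 7 / 12 * c')).
    by rewrite oppr_ge0 mul1r invr_le0; have := c0 => ?; rewrite cc'; lra.
  apply: geO_le (geO_scale s01 p0 L') _ => i.
  have n0 : 1 / 4 + 7 / 12 * c' != 0 by have := c0 => ?; rewrite cc'; lra.
  move: n0; set x := 1 / 4 + _ => n0.
  by rewrite le_eqVlt; apply/orP; left; apply/eqP; field.
have p0 : 0 <= 1 / (1 / 4 + 7 / 12 * c) by have := c0 => ?; rewrite divr_ge0; lra.
apply: geO_le (geO_scale s01 p0 L) _ => i.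
have n0 : 1 / 4 + 7 / 12 * c != 0 by have := c0 => ?; lra.
move: n0; set x := 1 / 4 + _ => n0.
by rewrite le_eqVlt; apply/orP; left; apply/eqP; field.
Qed.

Lemma isO_E1 : isO s 4 (fun i => E1 i + 8 / 5 * s i ^+ 2).
Proof.
have := isO_E2 => ?; have := isO_slack5 => ?.
apply: (@isO_ext _ _ _ _ (fun i => (E2 i - 6 / 5 * s i ^+ 2) - slack5 i)).
  by move=> i; rewrite /slack5; field.
isO_tac s01.
Qed.

(** At [E1 = - 8/5 s^2] and [E2 = 6/5 s^2], the linear part in [symA5_lin] vanishes for every
    [x]. *)
Lemma isO4_symA5 x : isO s 4 (symA5 x).
Proof.
apply: isO_eqmod (symA5_lin x) _.
apply: (@isO_ext _ _ _ _ (fun i => (E1 i + 8 / 5 * s i ^+ 2) * (1 - x) / 4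
   - (E2 i - 6 / 5 * s i ^+ 2) * (3 / 2 + x) / 3)).
  by move=> i; field.
have := isO_E1 => ?; have := isO_E2 => ?; isO_tac s01.
Qed.

(** Once [symA5] is negligible, the inequalities at [T] and [- T] bound the odd part from opposite
    sides. *)
Lemma isO4_asymA5 x T : key5 x T -> key5 x (- T) -> isO s 4 (asymA5 x T).
Proof.
have := isO4_symA5 x => OA k1 k2.
have L1 := geO_add (geO_reA5 k1) (isO_geO (isO_opp OA)).
have L2 := geO_add (geO_reA5 k2) (isO_geO (isO_opp OA)).
apply: geO_isO.
  by apply: geO_le L1 _ => i; lra.
by apply: geO_le L2 _ => i; rewrite /asymA5; lra.
Qed.

Lemma isO3_H1 : isO s 3 H1.
Proof.
have := isO4_asymA5 kp km => ?.
apply: (@isO_ext _ _ _ _ (fun i => 4 * (2 * c * H2 i / 3 + c * H3 i - H4 i)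
     - 4 * asymA5 c S i / S)).
  by have := S0 => ? i; rewrite /asymA5; field; lra.
clear OH1 OH1'; isO_tac s01.
Qed.

Lemma imA5_lin x T : isO s 3 (fun i => imA5 x T i + 2 / 5 * (1 + 2 * x) * T * s i ^+ 2).
Proof.
have := isO_E1 => ?; have := isO_E2 => ?; have := isO3_H1 => ?; clear OH1 OH1'.
apply: (@isO_ext _ _ _ _ (fun i => T * ((E1 i + 8 / 5 * s i ^+ 2) / 4 -
      2 * x / 3 * (E2 i - 6 / 5 * s i ^+ 2))
  + H1 i * (b i ^+ 4 - x) / 4
  - H2 i * (b i ^+ 3 - (- (1 / 2) - x)) / 3
  + (- (E3 i * (2 * x * T)) + H3 i * (b i ^+ 2 - (- (1 / 2) - x))) / 2
  - (- (E4 i * T) + H4 i * (b i - x)))).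
  by move=> i; rewrite /imA5; field.
isO_tac s01.
Qed.

Lemma imB5_lin x T : isO s 3 (fun i => imB5 x T i + 4 / 5 * (2 + 3 * x) * T * s i ^+ 2).
Proof.
have := isO_E1 => ?; have := isO_E2 => ?; have := isO3_H1 => ?; clear OH1 OH1'.
apply: (@isO_ext _ _ _ _ (fun i => T * ((E1 i + 8 / 5 * s i ^+ 2)  -
      2 * x * (E2 i - 6 / 5 * s i ^+ 2))
  - H1 i * x + H2 i * (- (1 / 2) - x)
  - (E3 i * (2 * x * T) + H3 i * (- (1 / 2) - x)) + (E4 i * T + H4 i * x))).
  by move=> i; rewrite /imB5; field.
isO_tac s01.
Qed.

Definition quad5 x T : R := T ^+ 2 * (2 / 5 * (1 + 2 * x)) * (3 / 5 + 2 / 5 * x).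

(* [quad5 * s^4] is the leading term of [imA5 * imB5 - 5/2 * imA5^2]. *)
Lemma geO5_reA5 x T : key5 x T -> key5 x (- T) ->
  geO s 5 (fun i => symA5 x i + asymA5 x T i + quad5 x T * s i ^+ 4).
Proof.
move=> k1 k2.
have := isO4_symA5 x => ?; have := isO4_asymA5 k1 k2 => ?.
have := isO_reB5 x T => ?; have := imA5_lin x T => OA; have := imB5_lin x T => OB.
have OimA' := isO_imA5 x T; have OimB' := isO_imB5 x T.
set a0 := 2 / 5 * (1 + 2 * x) * T in OA.
set b0 := 4 / 5 * (2 + 3 * x) * T in OB.
(* Here [- a0] and [- b0] are the leading coefficients of [imA5] and [imB5]. Their products are
   telescoped so that each one has a factor of order [s^3] and a factor of order [s^2]. *)
exists (fun i => 5 / 2 * (symA5 x i + asymA5 x T i) ^+ 2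
   - (symA5 x i + asymA5 x T i) * (reB5 x T i - 1)
   - ((imA5 x T i + a0 * s i ^+ 2) * (imB5 x T i)
      - a0 * s i ^+ 2 * (imB5 x T i + b0 * s i ^+ 2))
   + 5 / 2 * (imA5 x T i + a0 * s i ^+ 2) * (imA5 x T i - a0 * s i ^+ 2)).
  isO_tac s01.
move=> i; have := k1 i.
have -> : quad5 x T = a0 * b0 - 5 / 2 * a0 ^+ 2.
  by rewrite /quad5 /a0 /b0; field.
lra.
Qed.

Lemma geO5_symA5 x T : key5 x T -> key5 x (- T) ->
  geO s 5 (fun i => symA5 x i + quad5 x T * s i ^+ 4).
Proof.
move=> k1 k2.
have k2' : key5 x (- - T) by rewrite opprK.
have h : 0 <= 1 / 2 :> R by lra.
apply: geO_le (geO_scale s01 h (geO_add (geO5_reA5 k1 k2) (geO5_reA5 k2 k2'))) _.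
by move=> i; rewrite /asymA5 /quad5; lra.
Qed.

(** Weighted sum of [geO5_symA5] with weights [3 - 2 c]. The constant is
    [13/2 = - 14 + 98/5 + 9/10]: from [7 (1 - (1 - s^2)^5) / 5], from [7 s^2 (E2 - E1)] with
    [E2 - E1 = 14/5 s^2 + slack5], and from the two [quad5] terms. *)
Lemma second_order_quintic : geO s 5 (fun i =>
  13 / 2 * s i ^+ 4 - 5 / 2 * slack5 i + 15 / 4 * E3 i - 10 * E4 i).
Proof.
have c30 : 0 <= 3 - 2 * c by have := c1 => ?; lra.
have c30' : 0 <= 3 - 2 * c' by have := c0 => ?; rewrite cc'; lra.
have L := geO_add (geO_scale s01 c30 (geO5_symA5 kp km))
  (geO_scale s01 c30' (geO5_symA5 kp' km')).
apply: geO_eqmod L; have := isO_slack5 => ?.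
apply: (@isO_ext _ _ _ _ (fun i =>
    s i ^+ 6 * (14 - 7 * s i ^+ 2 + 7 / 5 * s i ^+ 4)
  + 7 * s i ^+ 2 * slack5 i
  + E1 i * s i ^+ 4 * (7 / 4) * (6 - 4 * s i ^+ 2 + s i ^+ 4)
  - E2 i * s i ^+ 4 * (7 / 3) * (3 - s i ^+ 2)
  + E3 i * (7 / 2) * (s i ^+ 2 * (- 2 + s i ^+ 2))
  + 7 * E4 i * s i ^+ 2)).
  move=> i.
  have -> : (3 - 2 * c) * (symA5 c i + quad5 c S * s i ^+ 4) +
    (3 - 2 * c') * (symA5 c' i + quad5 c' S' * s i ^+ 4) =
    7 * (1 - b i ^+ 5) / 5 + E1 i * (7 * b i ^+ 4 + 3) / 4
    - E2 i * (7 * b i ^+ 3 + 1 / 2) / 3 + E3 i * (7 * b i ^+ 2 + 1 / 2) / 2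
    - E4 i * (7 * b i + 3) + 9 / 10 * s i ^+ 4.
    have qE x T : x ^+ 2 + T ^+ 2 = 1 -> 4 * x ^+ 2 + 2 * x = 1 ->
      (3 - 2 * x) * quad5 x T = 7 / 10 + x.
      move=> xT hx; rewrite /quad5.
      have -> : T ^+ 2 = 1 - x ^+ 2 by rewrite -xT; ring.
      have h1 := congr1 (fun z => x * z) hx; have h2 := congr1 (fun z => x ^+ 3 * z) hx.
      by rewrite /= in h1 h2; lra.
    have hc' : 4 * c' ^+ 2 + 2 * c' = 1 by have := hc => ?; rewrite cc'; lra.
    have q1 := congr1 (fun z => z * s i ^+ 4) (qE _ _ cS hc).
    have q2 := congr1 (fun z => z * s i ^+ 4) (qE _ _ cS' hc').
    move: q1 q2; set Q := quad5 c S; set Q' := quad5 c' S' => q1 q2.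
    rewrite /symA5 cc'.
    have e1 := congr1 (fun z => E1 i * z) hc; have e2 := congr1 (fun z => E2 i * z) hc.
    have e3 := congr1 (fun z => E3 i * z) hc; have e4 := congr1 (fun z => E4 i * z) hc.
    by rewrite /= cc' in e1 e2 e3 e4 q1 q2; lra.
  by rewrite /slack5; field.
isO_tac s01.
Qed.

End DegreeFive.

(** * Degree five: elimination down to the imaginary parts *)

Section QuinticConfigurations.
Variables (R : rcfType) (I : Type) (s : I -> R).
Hypothesis s01 : forall i, 0 <= s i <= 1.
Hypothesis s_gt0 : forall i, 0 < s i.
Variables (a0 a1 a2 a3 b0 b1 b2 b3 : I -> R).
Hypotheses (Oa0 : isO s 2 a0) (Oa1 : isO s 2 a1) (Oa2 : isO s 2 a2)
  (Oa3 : isO s 2 a3) (Ob0 : isO s 1 b0) (Ob1 : isO s 1 b1)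
  (Ob2 : isO s 1 b2) (Ob3 : isO s 1 b3).

Hypotheses (D0 : away s a0 b0) (D1 : away s a1 b1) (D2 : away s a2 b2)
  (D3 : away s a3 b3).

Let re2 (a b a' b' : I -> R) i := a i * a' i - b i * b' i.
Let im2 (a b a' b' : I -> R) i := a i * b' i + b i * a' i.
Let re3 (a b a' b' a'' b'' : I -> R) i :=
  (a i * a' i - b i * b' i) * a'' i - (a i * b' i + b i * a' i) * b'' i.
Let im3 (a b a' b' a'' b'' : I -> R) i :=
  (a i * a' i - b i * b' i) * b'' i + (a i * b' i + b i * a' i) * a'' i.

Definition re_e1 i := a0 i + a1 i + a2 i + a3 i.
Definition im_e1 i := b0 i + b1 i + b2 i + b3 i.
Definition re_e2 i := re2 a0 b0 a1 b1 i + re2 a0 b0 a2 b2 i + re2 a0 b0 a3 b3 i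
  + re2 a1 b1 a2 b2 i + re2 a1 b1 a3 b3 i + re2 a2 b2 a3 b3 i.
Definition im_e2 i := im2 a0 b0 a1 b1 i + im2 a0 b0 a2 b2 i + im2 a0 b0 a3 b3 i
  + im2 a1 b1 a2 b2 i + im2 a1 b1 a3 b3 i + im2 a2 b2 a3 b3 i.
Definition re_e3 i := re3 a0 b0 a1 b1 a2 b2 i + re3 a0 b0 a1 b1 a3 b3 i
  + re3 a0 b0 a2 b2 a3 b3 i + re3 a1 b1 a2 b2 a3 b3 i.
Definition im_e3 i := im3 a0 b0 a1 b1 a2 b2 i + im3 a0 b0 a1 b1 a3 b3 i
  + im3 a0 b0 a2 b2 a3 b3 i + im3 a1 b1 a2 b2 a3 b3 i.
Definition re_e4 i := re2 a0 b0 a1 b1 i * re2 a2 b2 a3 b3 i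
   - im2 a0 b0 a1 b1 i * im2 a2 b2 a3 b3 i.
Definition im_e4 i := re2 a0 b0 a1 b1 i * im2 a2 b2 a3 b3 i
   + im2 a0 b0 a1 b1 i * re2 a2 b2 a3 b3 i.

Hypothesis crit_key : forall c S : R, 4 * c ^+ 2 + 2 * c = 1 -> c ^+ 2 + S ^+ 2 = 1 ->
  key5 s re_e1 re_e2 re_e3 re_e4 im_e1 im_e2 im_e3 im_e4 c S.

Notation away_slack := (away_slack s).

Let OE1 : isO s 2 re_e1. Proof. rewrite /re_e1; isO_tac s01. Qed.
Let OH1 : isO s 1 im_e1. Proof. rewrite /im_e1; isO_tac s01. Qed.
Let OE2 : isO s 2 re_e2. Proof. rewrite /re_e2 /re2; isO_tac s01. Qed.
Let OH2 : isO s 3 im_e2. Proof. rewrite /im_e2 /im2; isO_tac s01. Qed.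
Let OE3 : isO s 4 re_e3.
Proof.
apply: (@isO_ext _ _ _ _ (fun i => a0 i * (a1 i * a2 i + a1 i * a3 i + a2 i * a3 i)
 + a1 i * (a2 i * a3 i) - (a0 i * (b1 i * b2 i + b1 i * b3 i + b2 i * b3 i)
   + a1 i * (b0 i * b2 i + b0 i * b3 i + b2 i * b3 i)
   + a2 i * (b0 i * b1 i + b0 i * b3 i + b1 i * b3 i)
   + a3 i * (b0 i * b1 i + b0 i * b2 i + b1 i * b2 i)))).
  by move=> i; rewrite /re_e3 /re3; ring.
isO_tac s01.
Qed.
Let OH3 : isO s 3 im_e3. Proof. rewrite /im_e3 /im3; isO_tac s01. Qed.
Let OE4 : isO s 4 re_e4. Proof. rewrite /re_e4 /re2 /im2; isO_tac s01. Qed.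
Let OH4 : isO s 4 im_e4. Proof. rewrite /im_e4 /re2 /im2; isO_tac s01. Qed.

Let th := slack5 s re_e1 re_e2.
Let sum_slack i := away_slack a0 b0 i + away_slack a1 b1 i
  + away_slack a2 b2 i + away_slack a3 b3 i.
Let sqa i := a0 i ^+ 2 + a1 i ^+ 2 + a2 i ^+ 2 + a3 i ^+ 2.

(** Newton's identity for the real part of the second symmetric function; [14/5] is four times
    [7/10]. *)
Lemma slack5E i : th i = sum_slack i + (re_e1 i ^+ 2 - im_e1 i ^+ 2 - sqa i) / 2.
Proof.
by rewrite /th /slack5 /sum_slack /away_slack /sqa /re_e1 /im_e1 /re_e2 /re2; field.
Qed.

Lemma geO_sum_slack : geO s 4 sum_slack.
Proof.
exact: geO_add (geO_add (geO_add (geO_away_slack s01 Oa0 D0) (geO_away_slack s01 Oa1 D1))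
  (geO_away_slack s01 Oa2 D2)) (geO_away_slack s01 Oa3 D3).
Qed.

(** The cosines and sines of [2 pi / 5] and [4 pi / 5], obtained from the square root of 5. *)
Lemma golden_cosines : exists c c' S S' : R,
  [/\ 4 * c ^+ 2 + 2 * c = 1, c' = - (1 / 2) - c, 0 < c & c < 1] /\
  [/\ 0 < S, c ^+ 2 + S ^+ 2 = 1 & c' ^+ 2 + S' ^+ 2 = 1].
Proof.
pose q : R := Num.sqrt 5.
have qq : q ^+ 2 = 5 by rewrite sqr_sqrtr // ler0n.
have q0 : 0 <= q by exact: sqrtr_ge0.
have q2 : 2 < q by nra.
have q3 : q < 3 by nra.
exists ((q - 1) / 4), (- (q + 1) / 4), (Num.sqrt (1 - ((q - 1) / 4) ^+ 2)),
  (Num.sqrt (1 - (- (q + 1) / 4) ^+ 2)).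
have c1 : 0 < 1 - ((q - 1) / 4) ^+ 2 by nra.
have c2 : 0 <= 1 - (- (q + 1) / 4) ^+ 2 by nra.
split; split; try lra; rewrite ?sqrtr_gt0 ?sqr_sqrtr //; try lra.
Qed.

Definition e2b (x y z : I -> R) i := x i * y i + x i * z i + y i * z i.
Let f2 i := b0 i * b1 i + b0 i * b2 i + b0 i * b3 i + b1 i * b2 i
  + b1 i * b3 i + b2 i * b3 i.
Let f4 i := b0 i * b1 i * b2 i * b3 i.

Lemma quintic_away : exists2 eps, 0 < eps & forall i, eps <= s i.
Proof.
have [c [c' [S [S' [[hc cc' c0 c1] [S0 cS cS']]]]]] := golden_cosines.
have hc' : 4 * c' ^+ 2 + 2 * c' = 1 by rewrite cc'; lra.
have kp := crit_key hc cS; have kp' := crit_key hc' cS'.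
have km : key5 s re_e1 re_e2 re_e3 re_e4 im_e1 im_e2 im_e3 im_e4 c (- S).
  by apply: crit_key; rewrite ?sqrrN.
have km' : key5 s re_e1 re_e2 re_e3 re_e4 im_e1 im_e2 im_e3 im_e4 c' (- S').
  by apply: crit_key; rewrite ?sqrrN.
have OH1' := isO2_H1 s01 OE1 OE2 OE3 OE4 OH1 OH2 OH3 OH4 S0 kp km.
have Osq : isO s 4 (fun i => (re_e1 i ^+ 2 - im_e1 i ^+ 2 - sqa i) / 2).
  clear OH1; rewrite /sqa; isO_tac s01.
have Lslack : geO s 4 th.
  by apply: geO_le (geO_add geO_sum_slack (isO_geO Osq)) _ => i; rewrite slack5E.
have Oth : isO s 4 th.
  exact: (isO_slack5 s01 OE1 OE2 OE3 OE4 OH2 OH3 OH4 OH1' hc cc' c0 c1 kp km kp' km' Lslack).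
have isO_E2 : isO s 4 (fun i => re_e2 i - 6 / 5 * s i ^+ 2).
  exact: (isO_E2 s01 OE1 OE2 OE3 OE4 OH2 OH3 OH4 OH1' hc cc' c0 c1 kp km kp' km' Lslack).
have isO_E1 : isO s 4 (fun i => re_e1 i + 8 / 5 * s i ^+ 2).
  exact: (isO_E1 s01 OE1 OE2 OE3 OE4 OH2 OH3 OH4 OH1' hc cc' c0 c1 kp km kp' km' Lslack).
have isO3_H1 : isO s 3 im_e1.
  exact: (isO3_H1 s01 OE1 OE2 OE3 OE4 OH2 OH3 OH4 OH1' hc cc' c0 c1 S0 kp km kp' km' Lslack).
have L5 := second_order_quintic s01 OE1 OE2 OE3 OE4 OH2 OH3 OH4 OH1' hc cc' c0 c1 S0
  cS cS' kp km kp' km' Lslack.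
clear hc hc' cc' c0 c1 S0 cS cS' kp km kp' km' Lslack c c' S S'.
have isO_sum_slack : isO s 4 sum_slack.
  apply: (@isO_ext _ _ _ _ (fun i => th i - (re_e1 i ^+ 2 - im_e1 i ^+ 2 - sqa i) / 2)).
    by move=> i; rewrite slack5E addrK.
  isO_tac s01.
have L0 := geO_away_slack s01 Oa0 D0; have L1 := geO_away_slack s01 Oa1 D1.
have L2 := geO_away_slack s01 Oa2 D2; have L3 := geO_away_slack s01 Oa3 D3.
(* Four quantities [>= - O(s^4)] whose sum is [O(s^4)] are each [O(s^4)]: every distance constraint
   is tight at order [s^2]. *)
have Otau t u v w : geO s 4 t -> geO s 4 u -> geO s 4 v -> geO s 4 w ->
    (forall i, sum_slack i = t i + u i + v i + w i) -> isO s 4 t.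
  move=> Lt Lu Lv Lw e; apply: (geO_isO Lt).
  apply: geO_le (geO_add (geO_add (geO_add Lu Lv) Lw) (isO_geO (isO_opp isO_sum_slack))) _.
  by move=> i; rewrite e; lra.
have T0 : isO s 4 (away_slack a0 b0) by apply: Otau L0 L1 L2 L3 _.
have T1 : isO s 4 (away_slack a1 b1).
  by apply: Otau L1 L0 L2 L3 _ => i; rewrite /sum_slack; ring.
have T2 : isO s 4 (away_slack a2 b2).
  by apply: Otau L2 L0 L1 L3 _ => i; rewrite /sum_slack; ring.
have T3 : isO s 4 (away_slack a3 b3).
  by apply: Otau L3 L0 L1 L2 _ => i; rewrite /sum_slack; ring.
clear Otau L0 L1 L2 L3.
(* Summing [away_slack_ge] with [re_e1 = - 8/5 s^2] gives [slack5 >= 113/50 s^4 - sqa] up to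
   [O(s^5)], and [13/2 - 5/2 * 113/50 = 17/20]. *)
have L6 : geO s 5 (fun i => 17 / 20 * s i ^+ 4 + 5 / 2 * sqa i
    + 15 / 4 * re_e3 i - 10 * re_e4 i).
  have Or : isO s 5 (fun i => - (5 / 2) * (
     2 * s i ^+ 2 * (re_e1 i + 8 / 5 * s i ^+ 2) / 2
     + 9 / 25 * s i ^+ 6 - 9 / 50 * s i ^+ 8
     - (re_e1 i + 8 / 5 * s i ^+ 2) * (re_e1 i - 8 / 5 * s i ^+ 2) / 2
     + im_e1 i ^+ 2 / 2)).
    clear OH1 OH1'; isO_tac s01.
  apply: geO_le (geO_add L5 (isO_geO Or)) _ => i.
  have := away_slack_ge D0 i; have := away_slack_ge D1 i; have := away_slack_ge D2 i.
  have := away_slack_ge D3 i; have := slack5E i; rewrite /th /sum_slack /sqa /re_e1.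
  lra.
(* Since each [away_slack] is [O(s^4)], the real part [aj] equals [alpha bj] up to [O(s^4)] and can
   be eliminated. *)
pose alpha b i := - (7 / 10) * s i ^+ 2 + b i ^+ 2 / 2.
have L7 : geO s 5 (fun i => 17 / 20 * s i ^+ 4
    + 5 / 2 * (alpha b0 i ^+ 2 + alpha b1 i ^+ 2 + alpha b2 i ^+ 2 + alpha b3 i ^+ 2)
    - 15 / 4 * (alpha b0 i * e2b b1 b2 b3 i + alpha b1 i * e2b b0 b2 b3 i
      + alpha b2 i * e2b b0 b1 b3 i + alpha b3 i * e2b b0 b1 b2 i)
    - 10 * f4 i).
  apply: geO_eqmod L6.
  have Oal b : isO s 1 b -> isO s 2 (alpha b).
    move=> Ob; rewrite /alpha; isO_tac s01.
  have A0 := Oal _ Ob0; have A1 := Oal _ Ob1; have A2 := Oal _ Ob2.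
  have A3 := Oal _ Ob3.
  apply: (@isO_ext _ _ _ _ (fun i =>
   - (5 / 2) * (away_slack a0 b0 i * (a0 i + alpha b0 i) + away_slack a1 b1 i * (a1 i + alpha b1 i)
      + away_slack a2 b2 i * (a2 i + alpha b2 i) + away_slack a3 b3 i * (a3 i + alpha b3 i))
   + 15 / 4 * (a0 i * (a1 i * a2 i + a1 i * a3 i + a2 i * a3 i)
       + a1 i * (a2 i * a3 i)
      + (away_slack a0 b0 i * (b1 i * b2 i + b1 i * b3 i + b2 i * b3 i)
      + away_slack a1 b1 i * (b0 i * b2 i + b0 i * b3 i + b2 i * b3 i)
      + away_slack a2 b2 i * (b0 i * b1 i + b0 i * b3 i + b1 i * b3 i)
      + away_slack a3 b3 i * (b0 i * b1 i + b0 i * b2 i + b1 i * b2 i)))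
   - 10 * (a0 i * (a1 i * (a2 i * a3 i)) - a0 i * (a1 i * (b2 i * b3 i))
      - a0 i * (a2 i * (b1 i * b3 i)) - a0 i * (a3 i * (b1 i * b2 i))
      - a1 i * (a2 i * (b0 i * b3 i)) - a1 i * (a3 i * (b0 i * b2 i))
      - a2 i * (a3 i * (b0 i * b1 i))))).
    by move=> i; rewrite /re_e3 /re_e4 /re3 /re2 /im2 /sqa /f4 /e2b /alpha /away_slack; field.
  isO_tac s01.
clear L5 L6.
have Of2 : isO s 4 (fun i => f2 i + 6 / 5 * s i ^+ 2).
  apply: (@isO_ext _ _ _ _ (fun i => - (re_e2 i - 6 / 5 * s i ^+ 2)
    + (re_e1 i ^+ 2 - sqa i) / 2)).
    by move=> i; rewrite /f2 /re_e1 /re_e2 /re2 /sqa; field.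
  clear OH1; rewrite /sqa; isO_tac s01.
have Of2w : isO s 2 f2 by rewrite /f2; isO_tac s01.
(* By Newton's identities with [sum bj = O(s^3)] and [f2 = - 6/5 s^2], up to [O(s^5)]:
   [sum bj^2 = 12/5 s^2], [sum bj^4 = 72/25 s^4 - 4 f4], and the sum of [bj^2] times [e2b] of the
   other three is [- 4 f4]. *)
have L8 : geO s 5 (fun i => - (59 / 20) * s i ^+ 4 - 5 * f4 i).
  apply: geO_eqmod L7; clear OH1 OH1'.
  pose f3 i := b0 i * b1 i * b2 i + b0 i * b1 i * b3 i + b0 i * b2 i * b3 i
    + b1 i * b2 i * b3 i.
  have Of3 : isO s 3 f3 by rewrite /f3; isO_tac s01.
  pose p3 i := b0 i ^+ 3 + b1 i ^+ 3 + b2 i ^+ 3 + b3 i ^+ 3.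
  have Op3 : isO s 3 p3 by rewrite /p3; isO_tac s01.
  apply: (@isO_ext _ _ _ _ (fun i =>
     (f2 i + 6 / 5 * s i ^+ 2) * (35 / 4 * s i ^+ 2 + 5 / 4 * (f2 i - 6 / 5 * s i ^+ 2))
     + im_e1 i * (- (5 / 4) * (im_e1 i ^+ 3 - 4 * im_e1 i * f2 i + 4 * f3 i)
      - 7 / 4 * s i ^+ 2 * im_e1 i - 15 / 8 * (im_e1 i * f2 i - p3 i)))).
    by move=> i; rewrite /alpha /e2b /f3 /p3 /f2 /f4 /im_e1; field.
  isO_tac s01.
have L9 : geO s 5 (fun i => - (23 / 20) * s i ^+ 4).
  have Or : isO s 5 (fun i => - (5 / 16) * (4 * (f2 i + 6 / 5 * s i ^+ 2)
     * (f2 i - 6 / 5 * s i ^+ 2) + im_e1 i * (im_e1 i ^+ 3 - 4 * im_e1 i * f2 i))).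
    clear OH1 OH1'; isO_tac s01.
  apply: geO_le (geO_add L8 (isO_geO Or)) _ => i.
  rewrite /f2 /f4 /im_e1.
  (* With weights 1, 4, 4 these squares add up to [(sum bj^2)^2 + 16 f4], whence the lower bound on
     [f4]. *)
  have := sqr_ge0 (b0 i ^+ 2 + b1 i ^+ 2 - b2 i ^+ 2 - b3 i ^+ 2).
  have := sqr_ge0 (b0 i * b2 i + b1 i * b3 i).
  have := sqr_ge0 (b0 i * b3 i + b1 i * b2 i).
  lra.
have [g Og gle] := L9.
have a0' : 0 < 23 / 20 :> R by lra.
apply: (isO_away s_gt0 a0' (isO_opp Og)) => i.
by have := gle i; lra.
Qed.

End QuinticConfigurations.

(** * Critical values at the roots of unity *)

Section ComplexParts.
Variable R : rcfType.
Implicit Types x y : R[i].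

Lemma cReD x y : Re (x + y) = Re x + Re y. Proof. by case: x y => a b [c d]. Qed.
Lemma cImD x y : Im (x + y) = Im x + Im y. Proof. by case: x y => a b [c d]. Qed.
Lemma cReN x : Re (- x) = - Re x. Proof. by case: x. Qed.
Lemma cImN x : Im (- x) = - Im x. Proof. by case: x. Qed.
Lemma cReM x y : Re (x * y) = Re x * Re y - Im x * Im y.
Proof. by case: x y => a b [c d]. Qed.
Lemma cImM x y : Im (x * y) = Re x * Im y + Im x * Re y.
Proof. by case: x y => a b [c d]. Qed.
Lemma cRe_conj x : Re (conjc x) = Re x. Proof. by case: x. Qed.
Lemma cIm_conj x : Im (conjc x) = - Im x. Proof. by case: x. Qed.

Lemma cRe_nat k : Re (k%:R : R[i]) = k%:R.
Proof. by elim: k => // k IH; rewrite -natr1 cReD IH -natr1. Qed.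
Lemma cIm_nat k : Im (k%:R : R[i]) = 0.
Proof. by elim: k => // k IH; rewrite -natr1 cImD IH add0r. Qed.

End ComplexParts.

Section ComplexOrders.
Variables (R : rcfType) (I : Type) (s : I -> R).
Hypothesis s01 : forall i, 0 <= s i <= 1.
Implicit Types f g : I -> R[i].

Definition isOC k f :=
  isO s k (fun i => Re (f i)) /\ isO s k (fun i => Im (f i)).

Lemma isOC_ext k f g : f =1 g -> isOC k f -> isOC k g.
Proof. by move=> fg [h1 h2]; split; [apply: isO_ext h1|apply: isO_ext h2] => i; rewrite fg. Qed.

Lemma isOC_weak k l f : (l <= k)%N -> isOC k f -> isOC l f.
Proof. by move=> lk [h1 h2]; split; apply: isO_weak lk _. Qed.

Lemma isOC_cst c : isOC 0 (fun=> c).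
Proof. by split; apply: isO_cst. Qed.

Lemma bigC0 k : isOC k (fun=> 0).
Proof. by split; apply: isO0. Qed.

Lemma isOC_real k (f : I -> R) : isO s k f -> isOC k (fun i => (f i)%:C).
Proof. by move=> Of; split=> //; apply: isO0. Qed.

Lemma isOC_add k f g : isOC k f -> isOC k g -> isOC k (fun i => f i + g i).
Proof.
move=> [f1 f2] [g1 g2]; split; [apply: isO_ext (isO_add f1 g1)
  |apply: isO_ext (isO_add f2 g2)] => i; by rewrite ?cReD ?cImD.
Qed.

Lemma isOC_opp k f : isOC k f -> isOC k (fun i => - f i).
Proof.
move=> [f1 f2]; split; [apply: isO_ext (isO_opp f1)
  |apply: isO_ext (isO_opp f2)] => i; by rewrite ?cReN ?cImN.
Qed.

Lemma isOC_sub k f g : isOC k f -> isOC k g -> isOC k (fun i => f i - g i).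
Proof. by move=> Of Og; apply: isOC_add => //; apply: isOC_opp. Qed.

Lemma isOC_mul k l f g : isOC k f -> isOC l g -> isOC (k + l) (fun i => f i * g i).
Proof.
move=> [f1 f2] [g1 g2]; split.
  apply: isO_ext (isO_sub (isO_mul f1 g1) (isO_mul f2 g2)) => i.
  by rewrite cReM.
apply: isO_ext (isO_add (isO_mul f1 g2) (isO_mul f2 g1)) => i.
by rewrite cImM.
Qed.

Lemma isOC_mulw m k l f g : (m <= k + l)%N ->
  isOC k f -> isOC l g -> isOC m (fun i => f i * g i).
Proof. by move=> mkl Of Og; apply: isOC_weak mkl _; apply: isOC_mul. Qed.

Lemma isOC_sum (J : eqType) (r : seq J) k (f : J -> I -> R[i]) :
  (forall j, j \in r -> isOC k (f j)) -> isOC k (fun i => \sum_(j <- r) f j i).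
Proof.
elim: r => [|j r IH] Of.
  by apply: isOC_ext (bigC0 k) => i; rewrite big_nil.
apply: isOC_ext (isOC_add (Of j (mem_head _ _)) (IH _)) => [i|l lr].
  by rewrite big_cons.
by apply: Of; rewrite inE lr orbT.
Qed.

Lemma isOC_eqmod k f g : isOC k (fun i => f i - g i) -> isOC k g -> isOC k f.
Proof.
by move=> Ofg Og; apply: isOC_ext (isOC_add Ofg Og) => i; rewrite subrK.
Qed.

End ComplexOrders.

(** * Leading coefficients of the derivative *)

Section Expansion.
Variables (R : rcfType) (I : Type) (s : I -> R).
Hypothesis s01 : forall i, 0 <= s i <= 1.
Variable z : nat -> I -> R[i].
Notation C := R[i].

Definition crit_poly N i : {poly C} := \prod_(j < N) ('X - (z j i)%:P).
Definition esym1 N i : C := \sum_(j < N) z j i.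
(** The second elementary symmetric function, with pairs grouped by their larger index so that
    adding a point is one step. *)
Definition esym2 N i : C := \sum_(j < N) z j i * esym1 j i.

Lemma esym1S N i : esym1 N.+1 i = esym1 N i + z N i.
Proof. by rewrite /esym1 big_ord_recr. Qed.

Lemma esym2S N i : esym2 N.+1 i = esym2 N i + z N i * esym1 N i.
Proof. by rewrite /esym2 big_ord_recr. Qed.

Lemma esym2E N i : 2 * esym2 N i = esym1 N i ^+ 2 - \sum_(j < N) z j i ^+ 2.
Proof.
elim: N => [|N IH]; first by rewrite /esym1 /esym2 !big_ord0 expr0n subrr mulr0.
by rewrite esym2S mulrDr IH /esym1 !big_ord_recr /=; ring.
Qed.

Let main m i : {poly C} :=
  'X^m * ('X^2 - (esym1 m.+2 i)%:P * 'X + (esym2 m.+2 i)%:P).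

Hypothesis Oz : forall j, isOC s 1 (z j).

Lemma isOC_esym1 N : isOC s 1 (esym1 N).
Proof. by apply: isOC_sum => j _; apply: Oz. Qed.

Lemma isOC_esym2 N : isOC s 2 (esym2 N).
Proof.
by apply: isOC_sum => j _; apply: isOC_mul (Oz j) (isOC_esym1 j).
Qed.

(** The lower coefficients involve products of at least three points of size [O(s)]. In the
    induction, multiplying [main] by a new factor ['X - z] creates only one extra term,
    [- z e2 'X^m]. *)
Lemma crit_poly_main m j : isOC s 3 (fun i => (crit_poly m.+2 i - main m i)`_j).
Proof.
elim: m j => [|m IH] j.
  apply: isOC_ext (bigC0 _ _) => i.
  rewrite (_ : crit_poly 2 i - main 0 i = 0) ?coef0 //.
  rewrite /crit_poly /main /esym2 /esym1 !(big_ord_recr, big_ord0) /=.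
  by rewrite !add0r mul1r !mulr0 !add0r expr0 !polyCD polyCM; ring.
apply: (@isOC_ext _ _ _ _ (fun i => ((crit_poly m.+2 i - main m i) * 'X)`_j
  - (crit_poly m.+2 i - main m i)`_j * z m.+2 i
  - (z m.+2 i * esym2 m.+2 i) * ('X^m : {poly C})`_j)).
  move=> i; rewrite -!coefMC -coefB -coefCM -coefB; congr ((_ : {poly C})`_j).
  rewrite /crit_poly [in RHS]big_ord_recr /= -/(crit_poly m.+2 i).
  rewrite /main (esym2S m.+2) (esym1S m.+2).
  move: (crit_poly _ _) (esym1 _ _) (esym2 _ _) => P e1 e2.
  by rewrite !polyCD !polyCM (exprS _ m); ring.
apply: isOC_sub; first apply: isOC_sub.
- case: j => [|j]; first by apply: isOC_ext (bigC0 _ _) => i; rewrite coefMX.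
  by apply: isOC_ext (IH j) => i; rewrite coefMX.
- by apply: (isOC_mulw s01 _ (IH j) (Oz _)).
- apply: (isOC_mulw s01 (k := 3) (l := 0)) => //; last exact: isOC_cst.
  exact: isOC_mul (Oz _) (isOC_esym2 _).
Qed.

Lemma crit_poly_sum m (L : nat -> I -> C) : (forall k, isOC s 0 (L k)) ->
  isOC s 3 (fun i => \sum_(k < m.+3) (crit_poly m.+2 i)`_k * L k i -
    (L m.+2 i - esym1 m.+2 i * L m.+1 i + esym2 m.+2 i * L m i)).
Proof.
move=> OL.
apply: (@isOC_ext _ _ _ _ (fun i => \sum_(k < m.+3)
   (crit_poly m.+2 i - main m i)`_k * L k i)).
  move=> i; under eq_bigr => k _ do rewrite coefB mulrBl.
  rewrite sumrB; congr (_ - _).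
  have c j : (main m i)`_j = (j == m.+2)%:R - esym1 m.+2 i * (j == m.+1)%:R
     + esym2 m.+2 i * (j == m)%:R.
    rewrite /main mulrDr mulrBr -exprD addn2 coefD coefB coefXn.
    rewrite mulrCA -exprSr coefCM coefXn.
    by rewrite [_ * (esym2 _ _)%:P]mulrC coefCM coefXn.
  rewrite !big_ord_recr /= big1 => [|k _].
    have n1 k : (k.+1 == k) = false by rewrite gtn_eqF.
    have n2 k : (k.+2 == k) = false by rewrite gtn_eqF.
    have n3 k : (k == k.+1) = false by rewrite ltn_eqF.
    have n4 k : (k == k.+2) = false by rewrite ltn_eqF.
    by rewrite !c !eqxx !(n1, n2, n3, n4) /=; ring.
  rewrite c !ltn_eqF ?mulr0 ?addr0 ?subr0 ?mul0r //.
    by rewrite (ltn_trans (ltn_ord k)).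
  by rewrite (ltn_trans (ltn_ord k)).
apply: isOC_sum => k _; by apply: (isOC_mulw s01 _ (crit_poly_main _ _) (OL _)).
Qed.

End Expansion.

Lemma unity_conj (R : rcfType) n (w : R[i]) : w ^+ n.+1 = 1 -> w ^+ n = conjc w.
Proof.
move=> wn; have w1 : w * conjc w = 1.
  rewrite -sqr_normc; apply/eqP; rewrite -(@pexpr_eq1 _ _ n.+1) ?exprn_ge0 //.
  by rewrite exprAC -normrX wn normr1 expr1n.
have w0 : w != 0.
  by apply/eqP => w0; move/eqP: w1; rewrite w0 mul0r eq_sym oner_eq0.
by apply: (mulfI w0); rewrite -exprS wn w1.
Qed.

Lemma unity_norm (R : rcfType) n (w : R[i]) : w ^+ n.+1 = 1 ->
  Re w ^+ 2 + Im w ^+ 2 = 1.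
Proof.
move=> wn; have := wn; rewrite exprSr (unity_conj wn).
by case: w {wn} => a b /= [h _]; rewrite -h; ring.
Qed.

(** * The first-order inequalities, in any degree at least three *)

Section FirstOrder.
Variables (R : rcfType) (I : Type) (s : I -> R).
Hypothesis s01 : forall i, 0 <= s i <= 1.
Variables (z : nat -> I -> R[i]) (m : nat).
Notation C := R[i].
Notation b i := ((1 - s i ^+ 2)%:C).
Notation n := m.+3.
Notation N := m.+2.

(* With [P' = n * crit_poly] and [P(beta) = 0], [intA] is [P(w)/n] and [derB] is
   [w P'(w)/n], where [n = N + 1]. *)
Definition intA (N : nat) (w : C) i : C :=
  \sum_(k < N.+1) (crit_poly z N i)`_k * ((w ^+ k.+1 - b i ^+ k.+1) / k.+1%:R).
Definition derB (N : nat) (w : C) i : C :=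
  \sum_(k < N.+1) (crit_poly z N i)`_k * w ^+ k.+1.

Definition crit_key (N : nat) := forall (w : C), w ^+ N.+1 = 1 -> forall i,
  N.+1%:R / 2 * (Re (intA N w i) ^+ 2 + Im (intA N w i) ^+ 2) <=
  Re (intA N w i) * Re (derB N w i) + Im (intA N w i) * Im (derB N w i).

Hypothesis Oa : forall j, isO s 2 (fun i => Re (z j i)).
Hypothesis Ob : forall j, isO s 1 (fun i => Im (z j i)).
Hypothesis zaway : forall j, (j < N)%N ->
  away s (fun i => Re (z j i)) (fun i => Im (z j i)).
Hypothesis zkey : crit_key N.

Let Oz j : isOC s 1 (z j).
Proof. by split; [apply: isO_weak (Oa j)|]. Qed.

Let e1 := esym1 z N.
Let e2 := esym2 z N.
Let E1 i := \sum_(j < N) Re (z j i).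
Let H1 i := \sum_(j < N) Im (z j i).
Let Y i := \sum_(j < N) Im (z j i) ^+ 2.

Lemma Re_esym1 i : Re (e1 i) = E1 i.
Proof. by rewrite /e1 /esym1 /E1; elim/big_ind2: _ => // x x' y y' <- <-; rewrite cReD. Qed.
Lemma Im_esym1 i : Im (e1 i) = H1 i.
Proof. by rewrite /e1 /esym1 /H1; elim/big_ind2: _ => // x x' y y' <- <-; rewrite cImD. Qed.

Lemma isO_Re_esym1 : isO s 2 E1.
Proof. by apply: isO_sum => j _. Qed.
Lemma isO_Im_esym1 : isO s 1 H1.
Proof. by apply: isO_sum => j _. Qed.

(** One order better than [e2] itself: each term is a real part [O(s^2)] times an imaginary part
    [O(s)]. *)
Lemma isO_Im_esym2 : isO s 3 (fun i => Im (e2 i)).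
Proof.
have Op : isO s 3 (fun i => \sum_(j < N) Re (z j i) * Im (z j i)).
  by apply: isO_sum => j _; exact: isO_mul (Oa j) (Ob j).
have := isO_Re_esym1 => ?; have := isO_Im_esym1 => ?.
apply: (@isO_ext _ _ _ _ (fun i => E1 i * H1 i
   - \sum_(j < N) Re (z j i) * Im (z j i))).
  move=> i; have := congr1 (@complex.Im R) (esym2E z N i).
  rewrite -/e2 -/e1 cImD cImN.
  have -> : Im (\sum_(j < N) z j i ^+ 2) = \sum_(j < N) 2 * (Re (z j i) * Im (z j i)).
    elim/big_ind2: _ => // [x x' y y' <- <-|j _]; first by rewrite cImD.
    by rewrite expr2 cImM; ring.
  rewrite -mulr_sumr expr2 !cImM Re_esym1 Im_esym1 cRe_nat cIm_nat mul0r addr0.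
  by lra.
isO_tac s01.
Qed.

Lemma isO_Re_esym2 : isO s 4 (fun i => Re (e2 i) - (Y i - H1 i ^+ 2) / 2).
Proof.
have Op : isO s 4 (fun i => \sum_(j < N) Re (z j i) ^+ 2).
  by apply: isO_sum => j _; apply: isO_exp (Oa j).
have := isO_Re_esym1 => ?.
apply: (@isO_ext _ _ _ _ (fun i => (E1 i ^+ 2
   - \sum_(j < N) Re (z j i) ^+ 2) / 2)).
  move=> i; have := congr1 (@complex.Re R) (esym2E z N i).
  rewrite -/e2 -/e1 cReD cReN.
  have -> : Re (\sum_(j < N) z j i ^+ 2) = \sum_(j < N) Re (z j i) ^+ 2 - Y i.
    rewrite /Y -sumrB; elim/big_ind2: _ => // [x x' y y' <- <-|j _]; first by rewrite cReD.
    by rewrite expr2 cReM !expr2.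
  rewrite expr2 !cReM Re_esym1 Im_esym1 cRe_nat cIm_nat mul0r subr0.
  by lra.
isO_tac s01.
Qed.

Lemma isO_beta k : isO s 2 (fun i => 1 - (1 - s i ^+ 2) ^+ k).
Proof.
elim: k => [|k IH].
  by apply: isO_ext (isO0 s 2) => i; rewrite expr0 subrr.
apply: (@isO_ext _ _ _ _ (fun i => (1 - (1 - s i ^+ 2) ^+ k)
  + s i ^+ 2 * (1 - (1 - (1 - s i ^+ 2) ^+ k)))).
  by move=> i; rewrite (exprS _ k); move: (_ ^+ k) => p; ring.
isO_tac s01.
Qed.

Lemma isO_beta_lin k : isO s 4 (fun i => 1 - (1 - s i ^+ 2) ^+ k - k%:R * s i ^+ 2).
Proof.
elim: k => [|k IH].
  by apply: isO_ext (isO0 s 4) => i; rewrite expr0 subrr mul0r subrr.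
have := isO_beta k => ?.
apply: (@isO_ext _ _ _ _ (fun i => (1 - (1 - s i ^+ 2) ^+ k - k%:R * s i ^+ 2)
  - s i ^+ 2 * (1 - (1 - s i ^+ 2) ^+ k))).
  by move=> i; rewrite (exprS _ k) -natr1; move: (_ ^+ k) => p; ring.
isO_tac s01.
Qed.

Lemma betaX_real i k : b i ^+ k = ((1 - s i ^+ 2) ^+ k)%:C.
Proof. by rewrite rmorphXn. Qed.

Lemma natC_inv k : (k%:R : C)^-1 = (k%:R^-1)%:C.
Proof. by rewrite fmorphV rmorph_nat. Qed.

Let Oe1 : isOC s 1 e1. Proof. exact: isOC_esym1. Qed.
Let Oe2 : isOC s 2 e2. Proof. exact: isOC_esym2. Qed.

(** For [w^n = 1], the powers [w^(n-1)] and [w^(n-2)] are [conjc w] and its square. Replacing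
    [beta^k] by 1 costs [O(s^2)], harmless next to [e1] and [e2]; the top term gives
    [(1 - beta^n) / n = s^2 + O(s^4)]. *)
Lemma intA_exp (w : C) : w ^+ n = 1 -> isOC s 3 (fun i => intA N w i -
  ((s i ^+ 2)%:C - e1 i * ((conjc w - 1) / m.+2%:R) + e2 i * ((conjc w ^+ 2 - 1) / m.+1%:R))).
Proof.
move=> wn; have wc := unity_conj wn.
have wc2 : w ^+ m.+1 = conjc w ^+ 2.
  have e : (m.+2 * 2 = m.+3 + m.+1)%N by rewrite muln2 -addnn !(addSn, addnS).
  by rewrite -wc -exprM e exprD wn mul1r.
pose L k i := (w ^+ k.+1 - b i ^+ k.+1) / k.+1%:R.
have OL k : isOC s 0 (L k).
  apply: (isOC_mulw s01 (k := 0) (l := 0)) => //; last exact: isOC_cst.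
  apply: isOC_sub; first exact: isOC_cst.
  apply: (@isOC_ext _ _ _ _ (fun i => ((1 - (1 - (1 - s i ^+ 2) ^+ k.+1)))%:C)).
    by move=> i; rewrite betaX_real; congr (_%:C); rewrite opprB addrC subrK.
  by apply: isOC_real; have := isO_beta k.+1 => ?; isO_tac s01.
have Ld k x : w ^+ k.+1 = x ->
    isOC s 2 (fun i => L k i - (x - 1) / k.+1%:R).
  move=> wx; apply: (@isOC_ext _ _ _ _ (fun i => ((1 - (1 - s i ^+ 2) ^+ k.+1) / k.+1%:R)%:C)).
    move=> i; rewrite /L wx -mulrBl betaX_real natC_inv rmorphM rmorphB /=.
    by congr (_ * _); ring.
  by apply: isOC_real; have := isO_beta k.+1 => ?; isO_tac s01.
apply: (@isOC_ext _ _ _ _ (fun i =>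
   (intA N w i - (L N i - e1 i * L m.+1 i + e2 i * L m i))
   + (L N i - (s i ^+ 2)%:C)
   - e1 i * (L m.+1 i - (conjc w - 1) / m.+2%:R)
   + e2 i * (L m i - (conjc w ^+ 2 - 1) / m.+1%:R))).
  by move=> i; ring.
apply: isOC_add; first apply: isOC_sub; first apply: isOC_add.
- exact: crit_poly_sum.
- apply: (@isOC_ext _ _ _ _ (fun i =>
    ((1 - (1 - s i ^+ 2) ^+ n - n%:R * s i ^+ 2) / n%:R)%:C)).
    move=> i; rewrite /L wn betaX_real natC_inv -(rmorph1 (real_complex R)).
    rewrite -rmorphB -rmorphM -rmorphB /=; congr (_%:C).
    by rewrite mulrBl; congr (_ - _); rewrite mulrAC mulfV ?mul1r ?pnatr_eq0.
  by apply: isOC_real; have := isO_beta_lin n => ?; isO_tac s01.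
- by apply: (isOC_mulw s01 _ Oe1 (Ld _ _ wc)).
- by apply: (isOC_mulw s01 _ Oe2 (Ld _ _ wc2)).
Qed.

Lemma derB_exp (w : C) : w ^+ n = 1 -> isOC s 3 (fun i => derB N w i -
  (1 - e1 i * conjc w + e2 i * conjc w ^+ 2)).
Proof.
move=> wn; have wc := unity_conj wn.
have wc2 : w ^+ m.+1 = conjc w ^+ 2.
  have e : (m.+2 * 2 = m.+3 + m.+1)%N by rewrite muln2 -addnn !(addSn, addnS).
  by rewrite -wc -exprM e exprD wn mul1r.
have := crit_poly_sum s01 Oz m (L := fun k _ => w ^+ k.+1) (fun k => isOC_cst s _).
by rewrite wn wc wc2.
Qed.

Lemma Re_intA_exp (w : C) : w ^+ n = 1 -> isO s 3 (fun i => Re (intA N w i) -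
  (s i ^+ 2 + E1 i * (1 - Re w) / m.+2%:R - H1 i * Im w / m.+2%:R
   - (Y i - H1 i ^+ 2) * Im w ^+ 2 / m.+1%:R)).
Proof.
move=> wn; have [OA _] := intA_exp wn.
have := isO_Im_esym2 => ?; have := isO_Re_esym2 => ?.
apply: (@isO_ext _ _ _ _ (fun i => Re (intA N w i -
  ((s i ^+ 2)%:C - e1 i * ((conjc w - 1) / m.+2%:R)
    + e2 i * ((conjc w ^+ 2 - 1) / m.+1%:R)))
  - (Re (e2 i) - (Y i - H1 i ^+ 2) / 2) * (2 * Im w ^+ 2 / m.+1%:R)
  + Im (e2 i) * (2 * Re w * Im w / m.+1%:R))).
  move=> i; rewrite cReD cReN cReD cReD cReN !natC_inv expr2 !(cReM, cImM) !(cReD, cImD).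
  rewrite !(cReN, cImN) !(cReM, cImM) !(cRe_conj, cIm_conj) Re_esym1 Im_esym1 /=.
  have := unity_norm wn; set p := _^-1; set q := _^-1.
  move: (Re w) (Im w) => c S cS.
  rewrite (_ : c * c = 1 - S * S); first by field.
  by rewrite -cS; ring.
isO_tac s01.
Qed.

Lemma isOC_intA k (w : C) : (k <= 2)%N -> w ^+ n = 1 -> isOC s k e1 -> isOC s k (intA N w).
Proof.
move=> k2 wn Oe.
apply: isOC_eqmod (isOC_weak s01 _ (intA_exp wn)) _.
  exact: leq_trans k2 _.
apply: isOC_add; first apply: isOC_sub.
- apply: (isOC_weak s01 k2); apply: isOC_real; isO_tac s01.
- by apply: (isOC_mulw s01 _ Oe (isOC_cst s _)); rewrite addn0.
- by apply: (isOC_mulw s01 _ Oe2 (isOC_cst s _)); rewrite addn0.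
Qed.

Lemma isOC_derB k (w : C) : (k <= 2)%N -> w ^+ n = 1 -> isOC s k e1 ->
  isOC s k (fun i => derB N w i - 1).
Proof.
move=> k2 wn Oe; apply: (@isOC_ext _ _ _ _ (fun i =>
   (derB N w i - (1 - e1 i * conjc w + e2 i * conjc w ^+ 2))
   - e1 i * conjc w + e2 i * conjc w ^+ 2)).
  by move=> i; ring.
apply: isOC_add; first apply: isOC_sub.
- by apply: (isOC_weak s01 _ (derB_exp wn)); apply: leq_trans k2 _.
- by apply: (isOC_mulw s01 _ Oe (isOC_cst s _)); rewrite addn0.
- by apply: (isOC_mulw s01 _ Oe2 (isOC_cst s _)); rewrite addn0.
Qed.

(** Applied first with [k = 1] to improve the order of [H1], then with [k = 2]. *)
Lemma geO_Re_intA k (w : C) : (k <= 2)%N -> w ^+ n = 1 -> isOC s k e1 ->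
  geO s (k + k) (fun i => Re (intA N w i)).
Proof.
move=> k2 wn Oe; have [OA1 OA2] := isOC_intA k2 wn Oe.
have [OB1 OB2] := isOC_derB k2 wn Oe.
apply: (geO_key s01 OA1 OA2 _ _ (zkey wn)).
  by apply: isO_ext OB1 => i; rewrite cReD cReN.
by apply: isO_ext OB2 => i; rewrite cImD cImN subr0.
Qed.

Lemma unity_conjX (w : C) : w ^+ n = 1 -> conjc w ^+ n = 1.
Proof. by move=> wn; rewrite -rmorphXn wn rmorph1. Qed.

Lemma isO2_Im_esym1 (w : C) : w ^+ n = 1 -> Im w != 0 -> isO s 2 H1.
Proof.
move=> wn S0; have := isO_Re_esym1 => OE; have := isO_Im_esym1 => OH.
have OY : isO s 2 Y.
  by apply: isO_sum => j _; apply: isO_exp (Ob j).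
have main v : v ^+ n = 1 -> geO s 2 (fun i => - (H1 i * Im v / m.+2%:R)).
  move=> vn; apply: geO_eqmod (geO_Re_intA (k := 1) _ vn Oe1) => //.
  have := Re_intA_exp vn => ?.
  apply: (@isO_ext _ _ _ _ (fun i => (Re (intA N v i) -
  (s i ^+ 2 + E1 i * (1 - Re v) / m.+2%:R - H1 i * Im v / m.+2%:R
   - (Y i - H1 i ^+ 2) * Im v ^+ 2 / m.+1%:R)) +
    s i ^+ 2 + E1 i * ((1 - Re v) / m.+2%:R)
   - (Y i - H1 i ^+ 2) * (Im v ^+ 2 / m.+1%:R))).
    by move=> i; ring.
  isO_tac s01.
have L1 := main _ wn; have L2 := main _ (unity_conjX wn).
have O1 : isO s 2 (fun i => H1 i * Im w / m.+2%:R).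
  apply: geO_isO L1; apply: geO_le L2 _ => i.
  by rewrite cIm_conj mulrN mulNr opprK.
apply: (@isO_ext _ _ _ _ (fun i => (H1 i * Im w / m.+2%:R) * (m.+2%:R / Im w))).
  have k0 : m.+2%:R != 0 :> R by rewrite pnatr_eq0.
  by move: (m.+2%:R) k0 => k k0 i; field; rewrite S0 k0.
isO_tac s01.
Qed.

(** Averaging over [v] and its conjugate removes [H1]; adding [(1 - Re v) / (n - 1)] times the total
    slack removes [E1] and turns the coefficient of [s^2] into [1 - 7/10 (1 - Re v)]. The nonreal
    root [w] only provides [H1 = O(s^2)]. *)
Lemma first_order (w v : C) : w ^+ n = 1 -> Im w != 0 -> v ^+ n = 1 ->
  geO s 3 (fun i => (3 + 7 * Re v) / 10 * s i ^+ 2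
    + Y i * ((1 - Re v) / (2 * m.+2%:R) - (1 - Re v ^+ 2) / m.+1%:R)).
Proof.
move=> wn S0 vn; have OH := isO2_Im_esym1 wn S0; have OE := isO_Re_esym1.
have Oe : isOC s 2 e1.
  split; [apply: isO_ext OE|apply: isO_ext OH] => i.
    by rewrite Re_esym1.
  by rewrite Im_esym1.
have Lsum : geO s 4 (fun i => \sum_(j < N)
    away_slack s (fun i => Re (z j i)) (fun i => Im (z j i)) i).
  by apply: geO_sum => j _; apply: (geO_away_slack s01 (Oa j)); apply: zaway.
have main u : u ^+ n = 1 -> geO s 3 (fun i => s i ^+ 2 +
     E1 i * (1 - Re u) / m.+2%:R - H1 i * Im u / m.+2%:R - Y i * Im u ^+ 2 / m.+1%:R).
  move=> un; apply: geO_eqmod (geO_weak s01 _ (geO_Re_intA (k := 2) _ un Oe)) => //.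
  have := Re_intA_exp un => ?.
  apply: (@isO_ext _ _ _ _ (fun i => (Re (intA N u i) -
  (s i ^+ 2 + E1 i * (1 - Re u) / m.+2%:R - H1 i * Im u / m.+2%:R
   - (Y i - H1 i ^+ 2) * Im u ^+ 2 / m.+1%:R)) +
    H1 i ^+ 2 * (Im u ^+ 2 / m.+1%:R))).
    by move=> i; ring.
  isO_tac s01.
have c1 : 0 <= (1 - Re v) / m.+2%:R.
  rewrite divr_ge0 // subr_ge0.
  have := unity_norm vn; have := sqr_ge0 (Im v); nra.
have h2 : 0 <= 1 / 2 :> R by lra.
have L := geO_scale s01 h2 (geO_add (main _ vn) (main _ (unity_conjX vn))).
apply: geO_le (geO_add L (geO_weak s01 _ (geO_scale s01 c1 Lsum))) _ => // i.
rewrite cRe_conj cIm_conj sqrrN.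
have -> : \sum_(j < N) away_slack s (fun i => Re (z j i)) (fun i => Im (z j i)) i =
   - (7 / 10) * m.+2%:R * s i ^+ 2 + Y i / 2 - E1 i.
  rewrite /away_slack !sumrB big_split /= sumr_const card_ord -mulr_suml.
  by rewrite -[_ *+ N]mulr_natr -/(Y i) -/(E1 i); move: (N%:R) => k; ring.
have -> : Im v ^+ 2 = 1 - Re v ^+ 2 by rewrite -(unity_norm vn); ring.
have -> : (1 - Re v) / (2 * m.+2%:R) = (1 - Re v) / m.+2%:R / 2.
  by rewrite invfM mulrA [LHS]mulrAC.
have m2 : m.+2%:R * ((1 - Re v) / m.+2%:R) = 1 - Re v.
  by rewrite mulrC divfK // pnatr_eq0.
move: m2; set p := (1 - Re v) / m.+2%:R; set q := (1 - _ ^+ 2) / _ => m2.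
have e : - (7 / 10) * m.+2%:R * s i ^+ 2 * p = - (7 / 10) * s i ^+ 2 * (1 - Re v).
  by rewrite -m2; ring.
rewrite le_eqVlt; apply/orP; left; apply/eqP.
rewrite -[Y i * _ / _]mulrA -/q -[E1 i * _ / _]mulrA -/p.
rewrite (_ : p * (- (7 / 10) * m.+2%:R * s i ^+ 2 + Y i / 2 - E1 i) =
  - (7 / 10) * m.+2%:R * s i ^+ 2 * p + p * (Y i / 2 - E1 i)); last first.
  by move: (m.+2%:R : R) => k; field.
rewrite e; move: (m.+2%:R^-1 : R) => r.
by field.
Qed.

End FirstOrder.

(** * Weights on the roots of unity *)

Lemma complex_prim_root (R : rcfType) n : (0 < n)%N ->
  exists w : R[i], n.-primitive_root w.
Proof.
pose p : {poly R[i]} := 'X^n - 1; have [r Dp] := closed_field_poly_normal p.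
move=> n_gt0; rewrite (monicP _) ?monicXnsubC // scale1r in Dp.
have rn1 : all n.-unity_root r by apply/allP=> z; rewrite -root_prod_XsubC -Dp.
have sz_r : (n < (size r).+1)%N by rewrite -(size_prod_XsubC r id) -Dp size_XnsubC.
have [|z _ zP] := hasP (has_prim_root n_gt0 rn1 _ sz_r); last by exists z.
by rewrite -separable_prod_XsubC -Dp separable_Xn_sub_1 // pnatr_eq0 -lt0n.
Qed.

Section Chebyshev.
Variable R : rcfType.

(** Consecutive Chebyshev polynomials of the first kind, paired to make the two-term recurrence
    structural. *)
Fixpoint cheb2 (c : R) n : R * R :=
  if n is n'.+1 then let: (x, y) := cheb2 c n' in (y, 2 * c * y - x) else (1, c).
Definition cheb c n := (cheb2 c n).1.

Lemma chebSS c n : cheb c n.+2 = 2 * c * cheb c n.+1 - cheb c n.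
Proof. by rewrite /cheb /=; case: (cheb2 c n). Qed.

Lemma Re_exp_cheb (x : R[i]) n : Re x ^+ 2 + Im x ^+ 2 = 1 ->
  Re (x ^+ n) = cheb (Re x) n.
Proof.
move=> x1; suff : Re (x ^+ n) = cheb (Re x) n /\ Re (x ^+ n.+1) = cheb (Re x) n.+1.
  by case.
elim: n => [|n [IH IH1]]; first by rewrite expr0 expr1.
split=> //; rewrite chebSS -IH1 -IH !exprS !(cReM, cImM).
rewrite (_ : Im x * (Re x * Im (x ^+ n) + Im x * Re (x ^+ n)) =
   Re x * Im x * Im (x ^+ n) + (1 - Re x ^+ 2) * Re (x ^+ n)).
  by ring.
by rewrite -x1; ring.
Qed.

Definition chebsum (a : seq R) c := \sum_(j < size a) a`_j * cheb c j.

(** On the unit circle [cheb (Re v) j] is [Re (v^j)], whose sum over the roots of unity vanishes for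
    [0 < j < n]; only the constant coefficient survives. *)
Lemma sum_chebsum (w : R[i]) n (a : seq R) : n.-primitive_root w ->
  (0 < size a <= n)%N ->
  \sum_(v <- [seq w ^+ k | k <- iota 0 n]) chebsum a (Re v) = n%:R * a`_0.
Proof.
move=> wP /andP[a0 an]; have wn := prim_expr_order wP.
have n0 := prim_order_gt0 wP.
have w1 k : Re (w ^+ k) ^+ 2 + Im (w ^+ k) ^+ 2 = 1.
  have := @unity_norm R n.-1 (w ^+ k); rewrite prednK // -exprM mulnC exprM wn expr1n.
  exact.
rewrite big_map -[X in iota _ X]subn0 -/(index_iota 0 n) exchange_big /=.
rewrite (bigD1 (Ordinal a0)) //= [X in _ + X]big1 ?addr0.
  under eq_bigr => k _ do rewrite mulr1.
  by rewrite sumr_const_nat subn0 mulr_natl.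
move=> [j ja] /= j0; rewrite -mulr_sumr.
under eq_bigr => k _ do rewrite -Re_exp_cheb // -exprM mulnC exprM.
suff -> : \sum_(0 <= k < n) Re (w ^+ j ^+ k) = 0 by rewrite mulr0.
transitivity (Re (\sum_(0 <= k < n) w ^+ j ^+ k)).
  by elim/big_rec2: _ => // k x y _ ->; rewrite cReD.
have wj : w ^+ j - 1 != 0.
  rewrite subr_eq0 -(prim_order_dvd wP).
  apply/negP => /dvdn_leq; rewrite lt0n => /(_ j0).
  by rewrite leqNgt (leq_trans ja an).
rewrite big_mkord (_ : \sum_(k < n) _ = 0) //.
by apply: (mulfI wj); rewrite mulr0 -subrX1 -exprM mulnC exprM wn expr1n subrr.
Qed.

End Chebyshev.

(* Nonnegative weights [l] on the [n]-th roots of unity refuting the inequalities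
   of [first_order]. *)
Definition first_order_cert (R : rcfType) (n : nat) := exists (r : seq R[i])
    (l : R[i] -> R),
  [/\ forall v, v \in r -> v ^+ n = 1, forall v, v \in r -> 0 <= l v,
    \sum_(v <- r) l v * (3 + 7 * Re v) < 0 &
    n.-2%:R * (\sum_(v <- r) l v * (1 - Re v)) <=
    2 * n.-1%:R * (\sum_(v <- r) l v * (1 - Re v ^+ 2))].

(** A single primitive cube root of unity suffices: at [c = - 1/2] one has [3 + 7 c < 0], and the
    second condition reads [n - 2 <= n - 1]. *)
Lemma cert_cube (R : rcfType) n : (3 %| n)%N -> (0 < n)%N -> first_order_cert R n.
Proof.
case/dvdnP=> k -> k0; have [w wP] := complex_prim_root R (ltn0Sn 2).
have w3 := prim_expr_order wP.
have c : Re w = - (1 / 2).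
  have w1 : w != 1.
    apply/eqP => w1; have := prim_order_dvd wP 1.
    by rewrite w1 expr1n eqxx.
  have : w ^+ 2 + w + 1 = 0.
    apply: (mulfI (x := w - 1)); first by rewrite subr_eq0.
    rewrite mulr0; transitivity (w ^+ 3 - 1); first by ring.
    by rewrite w3 subrr.
  rewrite (unity_conj w3) => /(congr1 (@complex.Re R)).
  by rewrite !cReD cRe_conj /=; lra.
exists [:: w], (fun=> 1); split=> [v|v _||].
- by rewrite inE => /eqP->; rewrite mulnC exprM w3 expr1n.
- exact: ler01.
- by rewrite big_seq1 c; lra.
- rewrite !big_seq1 c.
  have : (k * 3).-2%:R <= (k * 3).-1%:R :> R by rewrite ler_nat; lia.
  have : 0 <= (k * 3).-2%:R :> R by rewrite ler0n.
  lra.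
Qed.

Lemma cert_cheb (R : rcfType) n (l : R -> R) (a b d : seq R) : (3 <= n)%N ->
  (0 < size a <= n)%N -> (0 < size b <= n)%N -> (0 < size d <= n)%N ->
  (forall c, c ^+ 2 <= 1 -> 0 <= l c) ->
  (forall c, l c * (3 + 7 * c) = chebsum a c) ->
  (forall c, l c * (1 - c) = chebsum b c) ->
  (forall c, l c * (1 - c ^+ 2) = chebsum d c) ->
  a`_0 < 0 -> n.-2%:R * b`_0 <= 2 * n.-1%:R * d`_0 -> first_order_cert R n.
Proof.
move=> n3 sa sb sd l0 la lb ld a0 bd.
have n0 : (0 < n)%N by apply: leq_trans n3.
have [w wP] := complex_prim_root R n0.
exists [seq w ^+ k | k <- iota 0 n], (fun v => l (Re v)).
have rn v : v \in [seq w ^+ k | k <- iota 0 n] -> v ^+ n = 1.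
  by case/mapP=> k _ ->; rewrite -exprM mulnC exprM (prim_expr_order wP) expr1n.
split=> // [v /rn vn||].
- apply: l0; have := @unity_norm R n.-1 v; rewrite prednK // => /(_ vn) <-.
  by rewrite lerDl sqr_ge0.
- under eq_bigr => v _ do rewrite la.
  by rewrite (sum_chebsum wP sa) pmulr_rlt0 // ltr0n.
- under eq_bigr => v _ do rewrite lb.
  under [X in _ <= _ * X]eq_bigr => v _ do rewrite ld.
  rewrite (sum_chebsum wP sb) (sum_chebsum wP sd) !(mulrCA _ n%:R).
  by rewrite ler_pM2l // ltr0n.
Qed.

(* In the three next lemmas the lists are the Chebyshev coefficients of [l], times
   [3 + 7 c], [1 - c] and [1 - c^2]. Concentrating near [c = - 1/2] is the point of
   the weights, subject to a degree small enough for the sums over the roots of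
   unity to be read off the constant coefficients. *)
Lemma cert_four (R : rcfType) : first_order_cert R 4.
Proof.
apply: (@cert_cheb R 4 (fun c => 1 - c) [:: - (1 / 2); 4; - (7 / 2)]
  [:: 3 / 2; - 2; 1 / 2] [:: 1 / 2; - (1 / 4); - (1 / 2); 1 / 4]) => //.
- by move=> c c1; nra.
- by move=> c; rewrite /chebsum !big_ord_recr big_ord0 /= /cheb /=; field.
- by move=> c; rewrite /chebsum !big_ord_recr big_ord0 /= /cheb /=; field.
- by move=> c; rewrite /chebsum !big_ord_recr big_ord0 /= /cheb /=; field.
- by rewrite /=; lra.
- by rewrite /=; lra.
Qed.

Lemma cert_small (R : rcfType) n : (7 <= n <= 10)%N -> first_order_cert R n.
Proof.
case/andP=> n7 n10.
apply: (@cert_cheb R n (fun c => (1 - c ^+ 2) * (3 * c - 2) ^+ 2)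
  [:: - (9 / 8); 47 / 8; - 6; - (31 / 16); 57 / 8; - (63 / 16)]
  [:: 37 / 8; - (41 / 8); - 2; 73 / 16; - (21 / 8); 9 / 16]
  [:: 33 / 16; - (3 / 2); - (73 / 32); 9 / 4; - (1 / 16); - (3 / 4); 9 / 32]).
- exact: leq_trans n7.
- by rewrite /=; apply: leq_trans n7.
- by rewrite /=; apply: leq_trans n7.
- by rewrite /=; apply: leq_trans n7.
- by move=> c c1; rewrite mulr_ge0 ?sqr_ge0 // subr_ge0.
- by move=> c; rewrite /chebsum !big_ord_recr big_ord0 /= /cheb /=; field.
- by move=> c; rewrite /chebsum !big_ord_recr big_ord0 /= /cheb /=; field.
- by move=> c; rewrite /chebsum !big_ord_recr big_ord0 /= /cheb /=; field.
- by rewrite /=; lra.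
(* The condition is [37 (n - 2) <= 33 (n - 1)], that is [4 n <= 41], hence the bound 10; the seven
   coefficients of the last list require [7 <= n]. *)
- have -> : n.-2 = (n - 2)%N by lia.
  have -> : n.-1 = (n - 1)%N by lia.
  have : n%:R <= 10 :> R by rewrite ler_nat.
  rewrite !natrB /=; first lra; lia.
Qed.

Lemma cert_large (R : rcfType) n : (10 <= n)%N -> first_order_cert R n.
Proof.
move=> n10.
apply: (@cert_cheb R n (fun c => (1 - c) * (3 - 7 * c - 3 * c ^+ 2 + 8 * c ^+ 3) ^+ 2)
  [:: - (23 / 16); 17 / 2; - (321 / 32); - (35 / 8); 263 / 16; - (75 / 8);
    - (175 / 32); 37 / 4; - (7 / 2)]
  [:: 189 / 16; - (47 / 4); - (297 / 32); 65 / 4; - (109 / 16); - (15 / 4);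
    185 / 32; - (11 / 4); 1 / 2]
  [:: 95 / 16; - (293 / 64); - (225 / 32); 525 / 64; - (9 / 16); - (273 / 64);
    81 / 32; 25 / 64; - (7 / 8); 1 / 4]).
- exact: leq_trans n10.
- by rewrite /=; apply: leq_trans n10.
- by rewrite /=; apply: leq_trans n10.
- by rewrite /=; apply: leq_trans n10.
- by move=> c c1; rewrite mulr_ge0 ?sqr_ge0 //; nra.
- by move=> c; rewrite /chebsum !big_ord_recr big_ord0 /= /cheb /=; field.
- by move=> c; rewrite /chebsum !big_ord_recr big_ord0 /= /cheb /=; field.
- by move=> c; rewrite /chebsum !big_ord_recr big_ord0 /= /cheb /=; field.
- by rewrite /=; lra.
(* Since [189 <= 2 * 95], the condition holds for all large degrees. *)
- have : n.-2%:R <= n.-1%:R :> R by rewrite ler_nat; lia.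
  have : 0 <= n.-2%:R :> R by rewrite ler0n.
  by rewrite /=; lra.
Qed.

Lemma first_order_certP (R : rcfType) n : (3 <= n)%N -> n != 5%N -> first_order_cert R n.
Proof.
move=> n3 n5; have [n10|n10] := leqP 10 n; first exact: cert_large.
have [n7|n7] := leqP 7 n; first by apply: cert_small; rewrite n7 ltnW.
case: (boolP (3 %| n)%N) => [d|nd]; first by apply: cert_cube; rewrite // (leq_trans _ n3).
have -> : n = 4%N by lia.
exact: cert_four.
Qed.

Lemma crit_poly4_coef (R : rcfType) (I : Type) (z : nat -> I -> R[i]) i :
  let P := crit_poly z 4 i in
  [/\ P`_4 = 1, P`_3 = - (z 0%N i + z 1%N i + z 2%N i + z 3%N i),
   P`_2 = z 0%N i * z 1%N i + z 0%N i * z 2%N i + z 0%N i * z 3%N i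
      + z 1%N i * z 2%N i + z 1%N i * z 3%N i + z 2%N i * z 3%N i,
   P`_1 = - (z 0%N i * z 1%N i * z 2%N i + z 0%N i * z 1%N i * z 3%N i
      + z 0%N i * z 2%N i * z 3%N i + z 1%N i * z 2%N i * z 3%N i) &
   P`_0 = z 0%N i * z 1%N i * (z 2%N i * z 3%N i)].
Proof.
rewrite /crit_poly !big_ord_recr big_ord0 /= mul1r.
move: (z 0%N i) (z 1%N i) (z 2%N i) (z 3%N i) => x y t u.
set e1 := x + y + t + u; set e2 := x * y + _ + _ + _ + _ + _.
set e3 := x * y * t + _ + _ + _; set e4 := x * y * (t * u).
have -> : ('X - x%:P) * ('X - y%:P) * ('X - t%:P) * ('X - u%:P) =
  'X^4 + (- e1)%:P * 'X^3 + e2%:P * 'X^2 + (- e3)%:P * 'X^1 + e4%:P * 'X^0.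
  by rewrite /e1 /e2 /e3 /e4 !(polyCN, polyCD, polyCM) expr1 expr0; ring.
by split; rewrite !coefD !coefCM !coefXn /= ?(mulr0, mulr1, addr0, add0r).
Qed.

(** * Lower bound on [s] for families of configurations *)

Section Configurations.
Variables (R : rcfType) (I : Type) (s : I -> R).
Hypothesis s01 : forall i, 0 <= s i <= 1.
Hypothesis s_gt0 : forall i, 0 < s i.
Variable z : nat -> I -> R[i].
Hypothesis Oa : forall j, isO s 2 (fun i => Re (z j i)).
Hypothesis Ob : forall j, isO s 1 (fun i => Im (z j i)).

Lemma first_order_away m :
  (forall j, (j < m.+2)%N -> away s (fun i => Re (z j i)) (fun i => Im (z j i))) ->
  crit_key s z m.+2 -> m.+3 != 5%N ->
  exists2 eps, 0 < eps & forall i, eps <= s i.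
Proof.
move=> zaway zkey n5.
have [w wP] := complex_prim_root R (ltn0Sn m.+2).
have wn := prim_expr_order wP.
have S0 : Im w != 0.
  apply/eqP => S0; have := unity_norm wn; rewrite S0 expr0n addr0 => c1.
  have : w ^+ 2 == 1.
    by rewrite eq_complex expr2 cReM cImM S0 !mulr0 mul0r subr0 addr0 -expr2 c1 /= !eqxx.
  by rewrite -(prim_order_dvd wP) => /dvdn_leq-/(_ isT).
have [r [l [r1 l0 lneg lY]]] := first_order_certP R (isT : (3 <= m.+3)%N) n5.
pose Y i := \sum_(j < m.+2) Im (z j i) ^+ 2.
have Y0 i : 0 <= Y i by apply: sumr_ge0 => j _; apply: sqr_ge0.
have L : geO s 3 (fun i => \sum_(v <- r) l v * ((3 + 7 * Re v) / 10 * s i ^+ 2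
    + Y i * ((1 - Re v) / (2 * m.+2%:R) - (1 - Re v ^+ 2) / m.+1%:R))).
  apply: geO_sum => // v vr; apply: geO_scale => //; first exact: l0.
  by have := first_order s01 Oa Ob zaway zkey wn S0 (r1 v vr).
set g := \sum_(v <- r) l v * (3 + 7 * Re v) in lneg.
have {}L : geO s 3 (fun i => g / 10 * s i ^+ 2).
  apply: geO_le L _ => i; move: (Y i) (Y0 i) => y y0.
  have -> : \sum_(v <- r) l v * ((3 + 7 * Re v) / 10 * s i ^+ 2
    + y * ((1 - Re v) / (2 * m.+2%:R) - (1 - Re v ^+ 2) / m.+1%:R)) =
    g / 10 * s i ^+ 2 + y * ((\sum_(v <- r) l v * (1 - Re v)) / (2 * m.+2%:R)
      - (\sum_(v <- r) l v * (1 - Re v ^+ 2)) / m.+1%:R).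
    rewrite /g !mulr_suml mulrBr !mulr_sumr -sumrB -big_split /=.
    by apply: eq_bigr => v _; move: (_^-1) (_^-1) => p q; ring.
  rewrite gerDl mulr_ge0_le0 // subr_le0 ler_pdivrMr ?mulr_gt0 ?ltr0n //.
  by rewrite mulrAC ler_pdivlMr ?ltr0n // mulrC (le_trans lY) // mulrC.
have [h Oh hle] := L.
have a0 : 0 < - (g / 10) by lra.
apply: (isO_away s_gt0 a0 (isO_opp Oh)) => i.
by have := hle i; lra.
Qed.

Lemma fifth_root (c S : R) : 4 * c ^+ 2 + 2 * c = 1 -> c ^+ 2 + S ^+ 2 = 1 ->
  let w := c +i* S in
  [/\ w ^+ 2 = (- (1 / 2) - c) +i* (2 * c * S),
      w ^+ 3 = (- (1 / 2) - c) +i* - (2 * c * S),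
      w ^+ 4 = c +i* - S & w ^+ 5 = 1].
Proof.
move=> hc cS w.
have S2 : S * S = 1 - c * c by rewrite -cS; ring.
have c2 : c * c = 1 / 4 - c / 2 by lra.
have w2 : w ^+ 2 = (- (1 / 2) - c) +i* (2 * c * S).
  apply/eqP; rewrite eq_complex expr2 cReM cImM /= S2 c2; apply/andP.
  by split; apply/eqP; field.
have w4 : w ^+ 4 = c +i* - S.
  rewrite (exprM w 2 2) w2 expr2; apply/eqP; rewrite eq_complex cReM cImM /=.
  apply/andP; split; apply/eqP.
    rewrite (_ : 2 * c * S * (2 * c * S) = 4 * (c * c) * (S * S)); last by ring.
    by rewrite S2 c2; lra.
  have := congr1 (fun x => S * x) c2; rewrite /= => h; lra.
have w5 : w ^+ 5 = 1.
  rewrite exprS w4; apply/eqP; rewrite eq_complex cReM cImM /=.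
  by apply/andP; split; apply/eqP; [rewrite mulrN opprK S2|]; ring.
split=> //; have w3 := @unity_conj R 4 _ w5.
by rewrite exprS w2; apply/eqP; rewrite eq_complex cReM cImM /=; apply/andP;
  split; apply/eqP; have := congr1 (fun x => S * x) c2;
  have := congr1 (fun x => c * x) c2; have := congr1 (fun x => c * x) S2;
  rewrite /= => h1 h2 h3; lra.
Qed.

Notation a j := (fun i => Re (z j i)).
Notation b j := (fun i => Im (z j i)).

Lemma quintic_key : crit_key s z 4 -> forall c S : R,
  4 * c ^+ 2 + 2 * c = 1 -> c ^+ 2 + S ^+ 2 = 1 ->
  key5 s (re_e1 (a 0) (a 1) (a 2) (a 3))
    (re_e2 (a 0) (a 1) (a 2) (a 3) (b 0) (b 1) (b 2) (b 3))
    (re_e3 (a 0) (a 1) (a 2) (a 3) (b 0) (b 1) (b 2) (b 3))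
    (re_e4 (a 0) (a 1) (a 2) (a 3) (b 0) (b 1) (b 2) (b 3))
    (im_e1 (b 0) (b 1) (b 2) (b 3))
    (im_e2 (a 0) (a 1) (a 2) (a 3) (b 0) (b 1) (b 2) (b 3))
    (im_e3 (a 0) (a 1) (a 2) (a 3) (b 0) (b 1) (b 2) (b 3))
    (im_e4 (a 0) (a 1) (a 2) (a 3) (b 0) (b 1) (b 2) (b 3)) c S.
Proof.
move=> zkey c S hc cS i.
have [w2 w3 w4 w5] := fifth_root hc cS; set w := c +i* S in w2 w3 w4 w5.
have [P4 P3 P2 P1 P0] := crit_poly4_coef z i.
have cE (x : R[i]) u v : Re x = u -> Im x = v -> x = u +i* v by case: x => ? ? /= -> ->.
set e1 := re_e1 _ _ _ _; set h1 := im_e1 _ _ _ _.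
set e2 := re_e2 _ _ _ _ _ _ _ _; set h2 := im_e2 _ _ _ _ _ _ _ _.
set e3 := re_e3 _ _ _ _ _ _ _ _; set h3 := im_e3 _ _ _ _ _ _ _ _.
set e4 := re_e4 _ _ _ _ _ _ _ _; set h4 := im_e4 _ _ _ _ _ _ _ _.
have {}P3 : (crit_poly z 4 i)`_3 = - (e1 i +i* h1 i).
  by rewrite P3; congr (- _); apply: cE; rewrite ?cReD ?cImD.
have {}P2 : (crit_poly z 4 i)`_2 = e2 i +i* h2 i.
  by rewrite P2; apply: cE; rewrite !(cReD, cImD) !(cReM, cImM).
have {}P1 : (crit_poly z 4 i)`_1 = - (e3 i +i* h3 i).
  by rewrite P1; congr (- _); apply: cE; rewrite !(cReD, cImD) !(cReM, cImM).
have {}P0 : (crit_poly z 4 i)`_0 = e4 i +i* h4 i.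
  by rewrite P0; apply: cE; rewrite !(cReM, cImM).
have eA : intA s z 4 w i = (symA5 s e1 e2 e3 e4 c i + asymA5 h1 h2 h3 h4 c S i)
   +i* imA5 s e1 e2 e3 e4 h1 h2 h3 h4 c S i.
  rewrite /intA !big_ord_recr big_ord0 /= P4 P3 P2 P1 P0.
  rewrite w2 w3 w4 w5 expr1 !betaX_real !natC_inv add0r.
  rewrite /symA5 /asymA5 /imA5.
  move: (e1 i) (e2 i) (e3 i) (e4 i) (h1 i) (h2 i) (h3 i) (h4 i) (s i).
  move=> {P0 P1 P2 P3 P4 w2 w3 w4 w5 e1 e2 e3 e4 h1 h2 h3 h4} e1 e2 e3 e4 h1 h2 h3 h4 x.
  by apply/eqP; rewrite eq_complex /=; apply/andP; split; apply/eqP; field.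
have eB : derB z 4 w i = reB5 e1 e2 e3 e4 h1 h2 h3 h4 c S i
   +i* imB5 e1 e2 e3 e4 h1 h2 h3 h4 c S i.
  rewrite /derB !big_ord_recr big_ord0 /= P4 P3 P2 P1 P0.
  rewrite w2 w3 w4 w5 expr1 add0r /reB5 /imB5.
  move: (e1 i) (e2 i) (e3 i) (e4 i) (h1 i) (h2 i) (h3 i) (h4 i).
  move=> {P0 P1 P2 P3 P4 w2 w3 w4 w5 e1 e2 e3 e4 h1 h2 h3 h4 eA} e1 e2 e3 e4 h1 h2 h3 h4.
  apply/eqP; rewrite eq_complex /=; apply/andP; split; apply/eqP; ring.
by have := zkey w w5 i; rewrite eA eB.
Qed.

Lemma configurations_away m :
  (forall j, (j < m.+2)%N -> away s (a j) (b j)) -> crit_key s z m.+2 ->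
  exists2 eps, 0 < eps & forall i, eps <= s i.
Proof.
(* The degree is [m.+3], so [m = 2] is the quintic case. *)
have [m2|m2] := eqVneq m 2%N; last by move=> za zk; apply: (first_order_away za zk); lia.
rewrite {}m2 => zaway zkey.
exact: (quintic_away s01 s_gt0 (Oa 0) (Oa 1) (Oa 2) (Oa 3) (Ob 0) (Ob 1) (Ob 2)
  (Ob 3) (zaway 0%N isT) (zaway 1%N isT) (zaway 2%N isT) (zaway 3%N isT)
  (quintic_key zkey)).
Qed.

End Configurations.

(** All configurations with the same [N] and [K] form one index type, so the [O] constants, and the
    final lower bound on [s], depend only on [N] and [K]. *)
Record configuration (R : rcfType) (N : nat) (K : R) := Configuration {
  conf_s : R;
  conf_z : nat -> R[i];
  _ : 0 < conf_s <= 1;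
  _ : forall j, `|Re (conf_z j)| <= K * conf_s ^+ 2;
  _ : forall j, `|Im (conf_z j)| <= K * conf_s;
  _ : forall j, (j < N)%N -> away (fun _ : unit => conf_s)
        (fun=> Re (conf_z j)) (fun=> Im (conf_z j));
  _ : crit_key (fun _ : unit => conf_s) (fun j _ => conf_z j) N }.

Lemma configuration_away (R : rcfType) m (K : R) :
  exists2 eps, 0 < eps & forall c : configuration m.+2 K, eps <= conf_s c.
Proof.
apply: (@configurations_away R (configuration m.+2 K) (@conf_s R m.+2 K) _ _
  (fun j c => conf_z c j) _ _ m).
- by case=> ? ? /= /andP[/ltW-> ->].
- by case=> ? ? /= /andP[].
- by move=> j; exists K; case.
- by move=> j; exists K; case.
- by move=> j jN [s z ? ? ? h ?] /=; exact: h j jN tt.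
- by move=> w wn [s z ? ? ? ? h] /=; exact: h w wn tt.
Qed.

(** * A priori bounds *)

(* With [k = (1/4)^N] a lower bound for the distance from [beta] to the other
   roots, [Re (1/(beta - zeta)) >= 1 - crit_cst N * (1 - beta)]. *)
Definition crit_cst (R : rcfType) (N : nat) : R := N%:R * (6 / (1 / 4) ^+ N ^+ 2 + 1).

Section RootsInDisk.
Variable R : rcfType.
Notation C := R[i].

Lemma normc_sqr (x : C) : normc x ^+ 2 = sqn x.
Proof. by case: x => a b /=; rewrite sqr_sqrtr // addr_ge0 ?sqr_ge0. Qed.

Lemma normc_ge0 (x : C) : 0 <= normc x.
Proof. by case: x => a b; apply: sqrtr_ge0. Qed.

Lemma sqnM (x y : C) : sqn (x * y) = sqn x * sqn y.
Proof. by rewrite cReM cImM; ring. Qed.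

Lemma normc_real (x : R) : 0 <= x -> normc x%:C = x.
Proof. by move=> x0; rewrite /= expr0n addr0 sqrtr_sqr ger0_norm. Qed.

Definition rootpoly (l : seq C) : {poly C} := \prod_(x <- l) ('X - x%:P).

Lemma rootpoly_cons x l : rootpoly (x :: l) = ('X - x%:P) * rootpoly l.
Proof. exact: big_cons. Qed.

(* [Re (w p'(w) / p(w)) >= deg p / 2] on the unit circle, without division. *)
Lemma disk_key (l : seq C) (w : C) : sqn w = 1 ->
  (forall x, x \in l -> sqn x <= 1) ->
  (size l)%:R / 2 * sqn (rootpoly l).[w] <=
  Re (rootpoly l).[w] * Re (w * (rootpoly l)^`().[w])
  + Im (rootpoly l).[w] * Im (w * (rootpoly l)^`().[w]).
Proof.
move=> w1; elim: l => [|x l IH] xl.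
  by rewrite /rootpoly big_nil derivC horner0 mulr0 /= !mulr0 addr0 !mul0r.
have := IH (fun y yl => xl y (mem_behead (s := x :: l) yl)).
have := xl x (mem_head _ _).
rewrite rootpoly_cons derivM derivXsubC mul1r !hornerE sqnM /= -[(size l).+1%:R]natr1.
move: (_.[w]) (_^`().[w]) => q q' x1 h.
rewrite !(cReM, cImM, cReD, cImD, cReN, cImN) in h *.
move: (Re w) (Im w) (Re x) (Im x) (Re q) (Im q) (Re q') (Im q') w1 x1 h.
move=> a b c d e f g k w1 x1 h.
set N := (size l)%:R in h *.
(* [h1] is the induction hypothesis times [|w - x|^2]. [h2] is the contribution of the new factor,
   from [2 Re (w conjc (w - x)) - |w - x|^2 = |w|^2 - |x|^2]. *)
have h1 : 0 <= ((a - c) ^+ 2 + (b - d) ^+ 2) * (e * (a * g - b * k) + f * (a * k + b * g)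
   - N / 2 * (e ^+ 2 + f ^+ 2)).
  by apply: mulr_ge0; [rewrite addr_ge0 ?sqr_ge0 | rewrite subr_ge0].
have h2 : 0 <= (e ^+ 2 + f ^+ 2) * (1 - (c ^+ 2 + d ^+ 2)).
  by apply: mulr_ge0; [rewrite addr_ge0 ?sqr_ge0 | rewrite subr_ge0].
have w1' := congr1 (fun z => (e ^+ 2 + f ^+ 2) * z) w1.
rewrite /= in w1'; lra.
Qed.

Lemma rootpoly_perm l l' : perm_eq l l' -> rootpoly l = rootpoly l'.
Proof. exact: perm_big. Qed.

Lemma rootpoly_horner l (x : C) : (rootpoly l).[x] = \prod_(u <- l) (x - u).
Proof.
by rewrite /rootpoly horner_prod; apply: eq_bigr => u _; rewrite !hornerE.
Qed.

Lemma rootpoly_logderiv l (x : C) : x \notin l ->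
  (rootpoly l)^`().[x] = (rootpoly l).[x] * \sum_(u <- l) (x - u)^-1.
Proof.
elim: l => [|u l IH]; first by rewrite /rootpoly !big_nil derivC horner0 mulr0.
rewrite inE negb_or => /andP[xu xl].
rewrite rootpoly_cons derivM derivXsubC mul1r !hornerE IH // big_cons.
have : x - u != 0 by rewrite subr_eq0.
by move: (x - u) (_.[x]) (\sum_(_ <- _) _) => t q S t0; field.
Qed.

Lemma normc_prod (l : seq C) (F : C -> C) :
  normc (\prod_(u <- l) F u) = \prod_(u <- l) normc (F u).
Proof. by elim/big_rec2: _ => [|u y x _ <-]; rewrite ?normc1 // normcM. Qed.

(** For [x = 1 - d - u], [|x|^2 - 2 Re x = |u|^2 - 1 + 2 d Re u + d^2 <= 6 d]; divide by
    [|x|^2 >= k^2]. *)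
Lemma Re_inv_disk (d k : R) (u : C) : 0 <= d <= 1 -> 0 < k ->
  sqn u <= 1 -> k <= normc ((1 - d)%:C - u) ->
  1 - 6 * d / k ^+ 2 <= 2 * Re ((1 - d)%:C - u)^-1.
Proof.
case/andP=> d0 d1 k0 u1 ku.
have kx : k ^+ 2 <= sqn ((1 - d)%:C - u).
  by rewrite -normc_sqr ler_pXn2r // nnegrE ?normc_ge0 // ltW.
move: kx u1; rewrite cReD cImD cReN cImN {ku}; case: u => a b /=.
set X := 1 - d - a; rewrite add0r sqrrN => kx u1.
have k2 : 0 < k ^+ 2 by rewrite exprn_gt0.
have x0 : 0 < X ^+ 2 + b ^+ 2 by apply: lt_le_trans kx.
have main : X ^+ 2 + b ^+ 2 - 6 * d <= 2 * X.
  have a1 : a <= 1 by have := sqr_ge0 b; nra.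
  have : 0 <= d * (1 - a) by rewrite mulr_ge0 // subr_ge0.
  have : 0 <= d * (1 - d) by rewrite mulr_ge0 // subr_ge0.
  by rewrite /X; lra.
apply: le_trans (_ : 1 - 6 * d / (X ^+ 2 + b ^+ 2) <= _).
  by rewrite lerD2l lerN2 ler_wpM2l ?mulr_ge0 // lef_pV2.
rewrite (_ : 1 - _ = (X ^+ 2 + b ^+ 2 - 6 * d) / (X ^+ 2 + b ^+ 2)).
  by rewrite mulrA ler_wpM2r // invr_ge0 ltW.
by rewrite mulrBl mulfV // gt_eqF.
Qed.

Lemma prod_const_le (l : seq C) (F : C -> R) (c : R) : 0 <= c ->
  (forall u, u \in l -> 0 <= F u <= c) -> \prod_(u <- l) F u <= c ^+ size l.
Proof.
move=> c0; elim: l => [|u l IH] Fl; first by rewrite big_nil expr0.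
rewrite big_cons exprS; have /andP[Fu0 Fu] := Fl u (mem_head _ _).
have Fl' v : v \in l -> 0 <= F v <= c.
  by move=> vl; apply: Fl; rewrite inE vl orbT.
apply: ler_pM => //; last exact: IH.
by rewrite big_seq prodr_ge0 // => v /Fl' /andP[].
Qed.

Lemma prod_const_ge (l : seq C) (F : C -> R) (c : R) : 0 <= c ->
  (forall u, u \in l -> c <= F u) -> c ^+ size l <= \prod_(u <- l) F u.
Proof.
move=> c0; elim: l => [|u l IH] Fl; first by rewrite big_nil expr0.
rewrite big_cons exprS; apply: ler_pM; rewrite ?exprn_ge0 //.
  exact: Fl (mem_head _ _).
by apply: IH => v vl; apply: Fl; rewrite inE vl orbT.
Qed.

Variables (us zs : seq C) (d : R) (N : nat).
Hypothesis d01 : 0 <= d <= 1.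
Let b : C := (1 - d)%:C.
Hypothesis size_us : size us = N.
Hypothesis size_zs : size zs = N.
Hypothesis us1 : forall u, u \in us -> sqn u <= 1.
Hypothesis deriv_p : (rootpoly (b :: us))^`() = N.+1%:R *: rootpoly zs.
Hypothesis zs_away : forall z, z \in zs ->
  1 - 3 / 10 * (1 - d) * d < normc (b - z).

Lemma normc_b_us u : u \in us -> normc (b - u) <= 2.
Proof.
move=> /us1 u1; apply: le_trans (le_normcD _ _) _.
rewrite normcN normc_real; last by case/andP: d01 => ? ?; lra.
have : normc u <= 1.
  by rewrite -(@ler_pXn2r _ 2) ?nnegrE ?normc_ge0 // expr1n normc_sqr.
by case/andP: d01 => ? ? ?; lra.
Qed.

Lemma crit_far z : z \in zs -> 1 / 2 <= normc (b - z).
Proof.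
move=> /zs_away h; apply: le_trans (ltW h).
by case/andP: d01 => ? ?; nra.
Qed.

(* Both sides are [P'(b)], for [P] monic. *)
Lemma deriv_at_b : \prod_(u <- us) (b - u) = N.+1%:R * \prod_(z <- zs) (b - z).
Proof.
rewrite -!rootpoly_horner -hornerZ -deriv_p rootpoly_cons derivM derivXsubC mul1r.
by rewrite !hornerE subrr mul0r addr0.
Qed.

(** In [deriv_at_b] the right side has modulus at least [(1/2)^N], and each of the other factors on
    the left is at most 2. *)
Lemma roots_far u : u \in us -> (1 / 4) ^+ N <= normc (b - u).
Proof.
move=> uus; have := congr1 (@normc R) deriv_at_b.
rewrite normcM !normc_prod (big_rem u) //= => e.
have h1 : (1 / 2) ^+ N <= \prod_(z <- zs) normc (b - z).
  by rewrite -size_zs; apply: prod_const_ge => [|z /crit_far]; lra.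
have N1 : 1 <= normc (N.+1%:R : C).
  rewrite -(rmorph_nat (real_complex R)) normc_real ?ler0n //.
  by rewrite ler1n.
have h2 : \prod_(v <- rem u us) normc (b - v) <= 2 ^+ N.
  apply: le_trans (prod_const_le (c := 2) _ _) _; first by lra.
    by move=> v /mem_rem /normc_b_us ->; rewrite normc_ge0.
  by rewrite ler_eXn2l ?ltr1n // size_rem // size_us leq_pred.
have h3 : (1 / 2) ^+ N <= normc (b - u) * 2 ^+ N.
  have p0 : 0 <= \prod_(z <- zs) normc (b - z).
    by apply: le_trans h1; rewrite exprn_ge0 //; lra.
  apply: (le_trans h1).
  apply: le_trans (_ : normc (N.+1%:R : C) * \prod_(z <- zs) normc (b - z) <= _).
    by rewrite ler_peMl.
  by rewrite -e ler_wpM2l ?normc_ge0.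
have -> : (1 / 4) ^+ N = (1 / 2) ^+ N / 2 ^+ N :> R.
  by rewrite -expr_div_n; congr (_ ^+ _); field.
by rewrite ler_pdivrMr // exprn_gt0.
Qed.

Lemma us_neq_b : b \notin us.
Proof.
apply/negP => /roots_far; rewrite subrr normc0; apply/negP; rewrite -ltNge.
by rewrite exprn_gt0 //; lra.
Qed.

Lemma zs_neq_b : b \notin zs.
Proof.
apply/negP => /crit_far; rewrite subrr normc0; apply/negP; rewrite -ltNge.
by lra.
Qed.

(** Two computations of [P''(b) / P'(b)]: from the roots of [P'], and from [P = ('X - b) Q], where
    [P'(b) = Q(b)] and [P''(b) = 2 Q'(b)]. *)
Lemma sum_inv_crit :
  \sum_(z <- zs) (b - z)^-1 = 2 * \sum_(u <- us) (b - u)^-1.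
Proof.
have := congr1 (fun p : {poly C} => p^`().[b]) deriv_p.
rewrite /= derivZ hornerZ (rootpoly_logderiv zs_neq_b) rootpoly_horner mulrA.
rewrite -deriv_at_b rootpoly_cons derivM derivXsubC mul1r derivD derivM.
rewrite derivXsubC mul1r !hornerD hornerM hornerXsubC subrr mul0r addr0.
rewrite (rootpoly_logderiv us_neq_b) rootpoly_horner.
have : \prod_(u <- us) (b - u) != 0.
  rewrite prodf_seq_neq0; apply/allP => u uus /=; rewrite subr_eq0.
  by apply: contraNneq us_neq_b => ->.
move: (\prod_(u <- us) _) => p p0 e; apply: (mulfI p0); rewrite -e; ring.
Qed.

Lemma Re_invE (x : C) : Re x^-1 = Re x / sqn x.
Proof. by case: x. Qed.

Notation M := (crit_cst R N).

(** By [sum_inv_crit] and [Re_inv_disk] the total over [zs] is at least [N (1 - 6 d / k^2)], while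
    each other term is at most [1 + d]. *)
Lemma Re_inv_crit z : z \in zs -> 1 - M * d <= Re (b - z)^-1.
Proof.
rewrite /crit_cst; case/andP: (d01) => d0 d1 zzs; set k := (1 / 4) ^+ N.
have k0 : 0 < k by rewrite exprn_gt0 //; lra.
have le1 x : x \in zs -> Re (b - x)^-1 <= 1 + d.
  move=> xzs; have h := zs_away xzs.
  have : normc (b - x)^-1 <= 1 + d.
    rewrite normcV -[leLHS]mul1r ler_pdivrMr; last by apply: le_lt_trans h; nra.
    by apply: le_trans (_ : (1 + d) * (1 - 3 / 10 * (1 - d) * d) <= _); [nra|];
      rewrite ler_wpM2l ?(ltW h) //; lra.
  apply: le_trans; apply: le_trans (ler_norm _) _.
  rewrite -(@ler_pXn2r _ 2) ?nnegrE ?normc_ge0 // normc_sqr.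
  by rewrite real_normK ?num_real // lerDl sqr_ge0.
have := congr1 (@complex.Re R) sum_inv_crit.
have Re_sum (l : seq C) : Re (\sum_(x <- l) (b - x)^-1) = \sum_(x <- l) Re (b - x)^-1.
  by elim/big_rec2: _ => // x u v _ <-; rewrite cReD.
rewrite cReM cRe_nat cIm_nat mul0r subr0 !Re_sum mulr_sumr (big_rem z) //=.
have h1 : \sum_(u <- us) (1 - 6 * d / k ^+ 2) <= \sum_(u <- us) 2 * Re (b - u)^-1.
  rewrite big_seq [leRHS]big_seq; apply: ler_sum => u uus.
  by apply: Re_inv_disk => //; [exact: us1 | exact: roots_far].
have h2 : \sum_(x <- rem z zs) Re (b - x)^-1 <= \sum_(x <- rem z zs) (1 + d).
  rewrite big_seq [leRHS]big_seq; apply: ler_sum => x /mem_rem; exact: le1.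
have N0 : (0 < N)%N by rewrite -size_zs; case: (zs) zzs.
have sum_cst (l : seq C) (x : R) : \sum_(u <- l) x = (size l)%:R * x.
  by rewrite big_const_seq count_predT iter_addr_0 mulr_natl.
move: h1 h2; rewrite !sum_cst size_us size_rem // size_zs -subn1 natrB // => h1 h2 e.
move: h1; rewrite -e.
have -> : N%:R * (6 / k ^+ 2 + 1) * d = N%:R * (6 * d / k ^+ 2) + N%:R * d by ring.
by move: (_ / k ^+ 2) => q h1; nra.
Qed.

Lemma crit_cst_ge0 : 0 <= M.
Proof.
by rewrite mulr_ge0 ?ler0n // addr_ge0 // divr_ge0 // !exprn_ge0 // divr_ge0.
Qed.

(** [Re_inv_crit] puts [b - z] in the disk of diameter [[0, 1 / (1 - M d)]], and [zs_away] puts it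
    outside a circle about 0 of radius [1 - O(d)]. The remaining crescent near 1 has width [O(d)]
    and height [O(sqrt d)]. *)
Lemma crit_bounds z : M * d <= 1 / 2 -> z \in zs ->
  `|Re z| <= (8 * M + 3) * d /\ Im z ^+ 2 <= (8 * M + 3) * d.
Proof.
case/andP: (d01) => d0 d1 Md zzs; have M0 := crit_cst_ge0.
have Md0 : 0 <= M * d by rewrite mulr_ge0.
have hr : (1 - 3 / 10 * (1 - d) * d) ^+ 2 < normc (b - z) ^+ 2.
  by rewrite ltr_pXn2r ?nnegrE ?normc_ge0 ?zs_away //; nra.
rewrite normc_sqr in hr; have := Re_inv_crit zzs.
rewrite Re_invE.
have eX : Re (b - z) = 1 - d - Re z by rewrite cReD cReN.
have eY : Im (b - z) ^+ 2 = Im z ^+ 2 by rewrite cImD cImN /= add0r sqrrN.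
move: hr; rewrite eY; move: (Im z ^+ 2) (sqr_ge0 (Im z)) => Y Y0.
have -> : Re z = 1 - d - Re (b - z) by rewrite eX; ring.
move: (Re (b - z)) => X hr.
have r2 : 1 - 3 / 5 * d <= X ^+ 2 + Y by apply: le_trans (ltW hr); nra.
have n0 : 0 < X ^+ 2 + Y by lra.
rewrite ler_pdivlMr // => hX.
rewrite mulrDl -mulrA; move: (M * d) Md Md0 hX => q q2 q0 hX.
have Xn : 0 <= (1 - q) * (X ^+ 2 + Y) by rewrite mulr_ge0 // ?(ltW n0) //; lra.
have X0 : 0 < X by have := sqr_ge0 X; nra.
have X1 : (1 - q) * X <= 1.
  by rewrite -(ler_pM2r X0); nra.
have X2 : X <= 1 + 2 * q by nra.
have X3 : 1 - q - 3 / 5 * d <= X by nra.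
split; first by rewrite ler_norml; apply/andP; split; lra.
have h1 : (1 - q) * Y <= X * (1 - (1 - q) * X) by nra.
have h2 : 1 - (1 - q) * X <= 2 * q + 3 / 5 * d by nra.
have h3 : X * (1 - (1 - q) * X) <= 2 * (2 * q + 3 / 5 * d).
  by apply: ler_pM => //; lra.
nra.
Qed.

End RootsInDisk.

Section Primitive.
Variables (R : rcfType) (N : nat) (zs us : seq R[i]) (b : R[i]).
Hypothesis deriv_p : (rootpoly (b :: us))^`() = N.+1%:R *: rootpoly zs.

Lemma rootpoly_coefS k :
  (rootpoly (b :: us))`_k.+1 = N.+1%:R * ((rootpoly zs)`_k / k.+1%:R).
Proof.
have := congr1 (fun p : {poly R[i]} => p`_k) deriv_p.
rewrite /= coef_deriv coefZ mulrA => <-.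
by rewrite -[X in _ = X / _]mulr_natr mulfK // pnatr_eq0.
Qed.

Lemma size_rootpoly (l : seq R[i]) : size (rootpoly l) = (size l).+1.
Proof. exact: size_prod_XsubC. Qed.

(** Subtracting the value 0 at [b] cancels the constant coefficient, the only one that the
    derivative does not determine. *)
Lemma rootpoly_primitive w : size us = N -> (rootpoly (b :: us)).[w] = N.+1%:R *
  \sum_(k < N.+1) (rootpoly zs)`_k * ((w ^+ k.+1 - b ^+ k.+1) / k.+1%:R).
Proof.
move=> size_us; have pb : (rootpoly (b :: us)).[b] = 0.
  by rewrite rootpoly_horner big_cons subrr mul0r.
have sp : (size (rootpoly (b :: us)) <= N.+2)%N by rewrite size_rootpoly /= size_us.
rewrite (_ : _.[w] = (rootpoly (b :: us)).[w] - (rootpoly (b :: us)).[b]);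
  last by rewrite pb subr0.
rewrite !(horner_coef_wide _ sp) -sumrB.
rewrite [LHS]big_ord_recl /= !expr0 subrr add0r mulr_sumr.
apply: eq_bigr => k _; rewrite /bump /= add1n rootpoly_coefS.
by move: (_^-1) => q; ring.
Qed.

End Primitive.

Lemma crit_poly_nth (R : rcfType) (I : Type) (zs : seq R[i]) (i : I) :
  crit_poly (fun j _ => nth 0 zs j) (size zs) i = rootpoly zs.
Proof. by rewrite /crit_poly /rootpoly (big_nth 0) big_mkord. Qed.

Lemma no_far_critical_points (R : rcfType) (N : nat) : (2 <= N)%N ->
  exists2 eps : R, 0 < eps & forall (d : R) (us zs : seq R[i]),
    0 <= d <= 1 -> d < eps -> size us = N -> size zs = N ->
    (forall u, u \in us -> sqn u <= 1) ->
    (rootpoly ((1 - d)%:C :: us))^`() = N.+1%:R *: rootpoly zs ->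
    (forall z, z \in zs -> 1 - 3 / 10 * (1 - d) * d < normc ((1 - d)%:C - z)) ->
    False.
Proof.
case: N => [|[|m]] // _; set N := m.+2.
pose M := crit_cst R N; pose K := 8 * M + 3.
have M0 : 0 <= M by exact: crit_cst_ge0.
have K1 : 1 <= K by rewrite /K; lra.
have [e e0 conf_away] := configuration_away m K.
have M1 : 0 < 2 * (M + 1) by lra.
(* The second bound gives [M d <= 1/2], as [crit_bounds] requires; the first contradicts [e <= s]
   for [s^2 = d]. *)
exists (Num.min (e ^+ 2) (2 * (M + 1))^-1).
  by rewrite lt_min exprn_gt0 // invr_gt0.
move=> d us zs d01 de size_us size_zs us1 dp zs_away.
move: de; rewrite lt_min => /andP[de dM].
case/andP: (d01) => d0 d1.
have Md : M * d <= 1 / 2.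
  by move: dM; rewrite -[X in _ < X]mul1r ltr_pdivlMr //; lra.
have bnd := crit_bounds d01 size_us size_zs us1 dp zs_away Md.
rewrite -/M -/K in bnd.
(* A [configuration] bounds its points at every index; beyond the list, the default 0 complies. *)
have nth_bnd j : `|Re (nth 0 zs j)| <= K * d /\ Im (nth 0 zs j) ^+ 2 <= K * d.
  have [jz|jz] := ltnP j (size zs); first by apply: bnd; apply: mem_nth.
  rewrite nth_default //= normr0 expr0n.
  by split; rewrite mulr_ge0 //; lra.
(* Configurations need [s > 0]. If [d = 0], the bounds force a critical point at 0, at distance
   exactly 1 from [b = 1]. *)
have [dz|dn] := eqVneq d 0.
  have [h1 h2] := nth_bnd 0%N.
  have z0 : nth 0 zs 0 = 0.
    move: h1 h2; rewrite dz mulr0 normr_le0 => /eqP r0 i0.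
    apply/eqP; rewrite eq_complex r0 /= eqxx /= -sqrf_eq0.
    by rewrite eq_le i0 sqr_ge0.
  have := zs_away (nth 0 zs 0); rewrite mem_nth ?size_zs // => /(_ isT).
  by rewrite z0 dz !subr0 mulr0 subr0 normc1 ltxx.
have dp0 : 0 < d by rewrite lt_def dn.
pose s := Num.sqrt d; have s2 : s ^+ 2 = d by rewrite sqr_sqrtr.
have s0 : 0 < s by rewrite sqrtr_gt0.
have c1 : 0 < s <= 1 by rewrite s0 -(@ler_pXn2r _ 2) ?nnegrE ?(ltW s0) // s2 expr1n.
have c2 j : `|Re (nth 0 zs j)| <= K * s ^+ 2 by rewrite s2; have [] := nth_bnd j.
have c3 j : `|Im (nth 0 zs j)| <= K * s.
  rewrite -(@ler_pXn2r _ 2) ?nnegrE ?mulr_ge0 ?(ltW s0) ?normr_ge0 //; last lra.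
  rewrite real_normK ?num_real // exprMn s2; have [_ h] := nth_bnd j.
  apply: (le_trans h); rewrite ler_wpM2r // expr2 ler_peMl //; lra.
have c4 j : (j < N)%N -> away (fun _ : unit => s)
    (fun=> Re (nth 0 zs j)) (fun=> Im (nth 0 zs j)).
  move=> jN _; rewrite s2.
  have jz : nth 0 zs j \in zs by rewrite mem_nth // size_zs.
  have h := zs_away _ jz.
  have := normc_sqr ((1 - d)%:C - nth 0 zs j).
  rewrite cReD cImD cReN cImN /= add0r sqrrN => <-.
  rewrite ler_pXn2r ?nnegrE ?normc_ge0 ?(ltW h) //; nra.
have c5 : crit_key (fun _ : unit => s) (fun j _ => nth 0 zs j) N.
  move=> w wn i.
  have w1 := unity_norm wn.
  have l1 x : x \in (1 - d)%:C :: us -> sqn x <= 1.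
    rewrite inE => /predU1P[->|]; last exact: us1.
    by rewrite /= expr0n addr0; nra.
  have := disk_key w1 l1; rewrite /= size_us.
  have n0 : 0 < N.+1%:R :> R by rewrite ltr0n.
  have eA : (rootpoly ((1 - d)%:C :: us)).[w] =
      N.+1%:R * intA (fun _ : unit => s) (fun j _ => nth 0 zs j) N w i.
    rewrite (rootpoly_primitive dp w size_us) /intA s2.
    by rewrite -size_zs crit_poly_nth.
  have eB : w * (rootpoly ((1 - d)%:C :: us))^`().[w] =
      N.+1%:R * derB (fun j (_ : unit) => nth 0 zs j) N w i.
    rewrite dp hornerZ mulrCA; congr (_ * _); rewrite /derB -[in RHS]size_zs crit_poly_nth.
    have sz : (size (rootpoly zs) <= (size zs).+1)%N by rewrite size_rootpoly.
    rewrite (horner_coef_wide _ sz) mulr_sumr; apply: eq_bigr => k _.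
    by rewrite exprS; ring.
  rewrite eA eB; move: (intA _ _ _ _ _) (derB _ _ _ _) => A B.
  rewrite !(cReM, cImM) cRe_nat cIm_nat !mul0r !subr0 !addr0.
  move: (N.+1%:R) n0 => n n0 h.
  have n2 : 0 < n ^+ 2 by rewrite exprn_gt0.
  by rewrite -(ler_pM2l n2); lra.
have := conf_away (Configuration c1 c2 c3 c4 c5); rewrite /= => es.
have : e ^+ 2 <= d by rewrite -s2 ler_pXn2r ?nnegrE ?(ltW e0) ?(ltW s0).
by rewrite leNgt de.
Qed.

(** Making [P] monic changes neither its roots nor its critical points. *)
Lemma disk_polys_factor (R : realType) (n : nat) (b : R[i]) (P : {poly R[i]}) :
  disk_polys b P -> size P = n.+2 -> exists us zs : seq R[i],
    [/\ size us = n, size zs = n, forall u, u \in us -> sqn u <= 1,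
      (rootpoly (b :: us))^`() = n.+1%:R *: rootpoly zs &
      forall z, z \in zs -> root P^`() z].
Proof.
case=> sP Pdisk Pb sPn.
have P0 : lead_coef P != 0 by rewrite lead_coef_eq0 -size_poly_gt0 sPn.
have [r Pr] := closed_field_poly_normal P; rewrite -/(rootpoly r) in Pr.
have rootP z : root P z = (z \in r) by rewrite Pr rootZ // root_prod_XsubC.
have br : b \in r by rewrite -rootP.
have prem := perm_to_rem br; set us := rem b r in prem.
have Pus : P = lead_coef P *: rootpoly (b :: us) by rewrite -(rootpoly_perm prem).
have sus : size us = n.
  by move: sPn; rewrite Pus size_scale // size_rootpoly /= => -[].
set p := rootpoly (b :: us) in Pus *.
have sp : size p = n.+2 by rewrite size_rootpoly /= sus.
have [zs Dp] := closed_field_poly_normal p^`(); rewrite -/(rootpoly zs) in Dp.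
have sp' : size p^`() = n.+1 by rewrite size_deriv_complex sp.
have lp : lead_coef p^`() = n.+1%:R.
  rewrite lead_coefE sp' coef_deriv /=.
  have : lead_coef p = 1 by apply/monicP; exact: monic_prod_XsubC.
  by rewrite lead_coefE sp /= => ->.
have n0 : n.+1%:R != 0 :> R[i] by rewrite pnatr_eq0.
exists us, zs; split=> //.
- by move: sp'; rewrite Dp lp size_scale // size_rootpoly => -[].
- move=> u /mem_rem; rewrite -rootP => /Pdisk.
  rewrite [`|u|]normc_def -[1]/(1%:C) lecR => u1.
  have := normc_sqr u; rewrite /normc; case: (u) u1 => x y /= u1 <-.
  by rewrite expr_le1 // sqrtr_ge0.
- by rewrite Dp lp.
- move=> z zzs; rewrite Pus derivZ rootZ // Dp lp rootZ // root_prod_XsubC //.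
Qed.

Theorem theorem3 (R : realType) (n : nat) (hn : (2 <= n)%N) :
  exists2 eps : R, 0 < eps &
    forall beta : R, 0 <= beta <= 1 -> 1 - beta < eps ->
      (max_crit_dist n beta%:C <= (1 - 3 / 10 * beta * (1 - beta))%:E)%E.
Proof.
case: n hn => [|n] // hn.
have [eps eps0 no_far] : exists2 eps : R, 0 < eps &
    forall (d : R) (us zs : seq R[i]),
    0 <= d <= 1 -> d < eps -> size us = n -> size zs = n ->
    (forall u, u \in us -> sqn u <= 1) ->
    (rootpoly ((1 - d)%:C :: us))^`() = n.+1%:R *: rootpoly zs ->
    (forall z, z \in zs -> 1 - 3 / 10 * (1 - d) * d < normc ((1 - d)%:C - z)) ->
    False.
  (* The degree is now [n.+1]. In degree 2 the critical point is the midpoint of the roots, so its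
     distance to [b] is at most [1 - d/2], below the assumed bound. *)
  have [n1|n2] := leqP n 1; last exact: no_far_critical_points.
  exists 1 => // d us zs /andP[d0 d1] _ sus szs us1 dp zs_far.
  have {n1 hn} n1 : n = 1%N by apply/eqP; rewrite eqn_leq n1.
  have := deriv_at_b dp; move: sus szs us1 zs_far; rewrite n1.
  case: us {dp} => [|u []] // _; case: zs => [|z []] // _ us1 zs_far.
  rewrite !big_seq1 => /(congr1 (@normc R)).
  have := zs_far z (mem_head _ _); have := us1 u (mem_head _ _).
  rewrite -normc_sqr normcM -(rmorph_nat (real_complex R)) normc_real ?ler0n //.
  move=> u1 zf e.
  have u1' : normc u <= 1 by rewrite -(@ler_pXn2r _ 2) ?nnegrE ?normc_ge0 // expr1n.
  have := le_normcD (1 - d)%:C (- u).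
  by rewrite normcN normc_real ?subr_ge0 // e; nra.
exists eps => // beta /andP[b0 b1] beta_eps.
apply: ge_ereal_sup => _ [P [Pdisk sP] <-]; rewrite lee_fin leNgt; apply/negP => far.
have [us [zs [sus szs us1 dp rootz]]] := disk_polys_factor Pdisk sP.
have sP2 : (2 < size P)%N by rewrite sP.
(* As the infimum is attained, a value of [crit_dist] above the bound puts every critical point
   strictly beyond it. *)
have [zeta _ [Pzeta zeta_min]] := crit_dist_min beta%:C sP2.
apply: (no_far (1 - beta) us zs) => //; rewrite ?subKr ?subr_ge0 //.
  by rewrite b1 gerBl.
move=> z /rootz /zeta_min; apply: lt_le_trans.
by rewrite -Pzeta.
Qed.
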